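(* Let $L$ be a finite extension of $\mathbb Q_p$ with uniformizer $\pi_L$, $\theta\in\widehat\Delta$, and $a\in O_L$ with $a(a-1)\not\equiv 0\pmod{\pi_L}$. Then $M'(T,\theta,a)\equiv 0\pmod{\pi_L}$ (derivative with respect to $T$, congruence coefficientwise in $O_L[[T]]$) if and only if $a\equiv-1\pmod{\pi_L}$ and $\theta$ is odd.
   Context: Let $p\ge5$ be prime; $\zeta_{p^{n+1}}$ compatible primitive $p^{n+1}$-th roots of unity, $K_n=\mathbb Q_p(\zeta_{p^{n+1}})$, $\Gamma_n=\mathrm{Gal}(K_n/K_0)$, $\gamma_0\in\varprojlim\Gamma_n$ acting by $\zeta\mapsto\zeta^{1+p}$. For $a\in\mathbb Z_p^*$: $\omega(a)$ Teichmüller, $\langle a\rangle=a/\omega(a)$, $\gamma_n(a)\in\Gamma_n$: $\zeta_{p^{n+1}}\mapsto\zeta_{p^{n+1}}^{\langle a\rangle}$. $\widehat\Delta$ is the group of characters $\theta:(\mathbb Z/p)^*\cong\Delta\to\mu_{p-1}$ (powers of $\omega$), $\theta(k)$ for $p\nmid k$; $\theta$ is even if $\theta(-1)=1$ and odd if $\theta(-1)=-1$. $\Lambda_L=O_L[[T]]\cong\varprojlim O_L[\Gamma_n]$ with $T\leftrightarrow\gamma_0-1$. For $\theta\in\widehat\Delta$ and $a\in O_L$ with $a(a-1)\not\equiv0\pmod{\pi_L}$, $M_n(\theta,a)=\sum_{1\le k\le p^{n+1}-1,\,p\nmid k}\frac{a^k}{a^{p^{n+1}}-1}\theta(k)\omega^{-1}(k)\gamma_n(k)\in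 O_L[\Gamma_n]$; these form a compatible system under restriction, and $M(T,\theta,a)\in\Lambda_L$ denotes the corresponding power series. *)

(* Defs.v *)
From HB Require Import structures.
From mathcomp Require Import all_boot all_order all_algebra.
Set Implicit Arguments. Unset Strict Implicit. Unset Printing Implicit Defensive.
Import Order.TTheory GRing.Theory Num.Theory.

(* Exponent of gamma_n(k) w.r.t. gamma_0 in Gamma_n ~ Z/p^n :
   gamma_n(k) = gamma_0^e  where (1+p)^e = <k> = k / omega(k)  (mod p^(n+1)),
   omega(k) mod p^(n+1) being the unique t mod p^(n+1) with t^(p-1) = 1 and
   t = k (mod p).  Returns 0 if no such e < p^n exists (never happens for p∤k). *)
Definition gexp (p n k : nat) : nat :=
  if [pick e : 'I_(p ^ n) | [exists t : 'I_(p ^ n.+1),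
        [&& (t ^ p.-1 == 1 %[mod p ^ n.+1]), (t == k %[mod p])
          & ((1 + p) ^ e * t == k %[mod p ^ n.+1])]]]
  is Some e then nat_of_ord e else 0.

Local Open Scope ring_scope.

Definition dvdr (R : comNzRingType) (x y : R) : Prop := exists z : R, y = x * z.

(* O is (isomorphic to) the ring of integers O_L of a finite extension L of Q_p,
   with uniformizer pi: a complete discrete valuation ring of characteristic 0,
   with uniformizer pi, finite residue field, and p in the maximal ideal. *)
Definition is_padic_integers (p : nat) (O : idomainType) (pi : O) : Prop :=
  (forall n : nat, (0 < n)%N -> n%:R != 0 :> O) /\
      pi != 0 /\ pi \notin GRing.unit /\
      (forall x : O, x != 0 -> exists (k : nat) (u : O), u \in GRing.unit /\ x = u * pi ^+ k) /\
      dvdr pi p%:R /\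
      (exists s : seq O, forall x : O, exists2 y, y \in s & dvdr pi (x - y)) /\
      (forall x : nat -> O, (forall n, dvdr (pi ^+ n) (x n.+1 - x n)) ->
         exists y : O, forall n, dvdr (pi ^+ n) (y - x n)).

Definition is_teichmuller (p : nat) (O : idomainType) (pi : O) (w : int -> O) : Prop :=
  forall k : int, ~~ (p%:Z %| k)%Z -> w k ^+ p.-1 = 1 /\ dvdr pi (w k - k%:~R).

Definition theta_omega_inv (O : idomainType) (w : int -> O) (i : nat) (k : nat) : O :=
  w k%:Z ^+ i * (w k%:Z)^-1.

(* M_n(theta,a) in O[Gamma_n] ~ O[T]/((1+T)^(p^n) - 1), gamma_0 <-> 1+T *)
Definition Mpoly (O : idomainType) (p n : nat) (w : int -> O) (i : nat) (a : O) : {poly O} :=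
  \sum_(1 <= k < p ^ n.+1 | ~~ (p %| k)%N)
     ((a ^+ k / (a ^+ (p ^ n.+1) - 1)) * theta_omega_inv w i k) *: ('X + 1) ^+ gexp p n k.

Definition psmul (O : comNzRingType) (f g : nat -> O) : nat -> O :=
  fun m => \sum_(j < m.+1) f j * g (m - j)%N.

(* F in O[[T]] is M(T,theta,a): its image in Lambda/((1+T)^(p^n)-1) ~ O[Gamma_n]
   is M_n(theta,a) for every n *)
Definition is_Mseries (O : idomainType) (p : nat) (w : int -> O) (i : nat) (a : O)
  (F : nat -> O) : Prop :=
  forall n : nat, exists G : nat -> O, forall m : nat,
    F m - (Mpoly p n w i a)`_m = psmul (fun j => ((('X + 1) ^+ (p ^ n) - 1 : {poly O}))`_j) G m.

(* Main.v *)
(** Write q = p^(N+1), and let psi = theta omega^-1.  If M' vanishes mod pi, then so does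
    the coefficient of gamma_0^e in M_N for every e prime to p, that is
      sum_eta psi(eta) a^(x eta mod q) = 0  mod pi,
    with eta ranging over the (p-1)-th roots of unity mod q, for all x = 1 + p m mod p^2
    with m prime to p.  For h(y) = a^(y mod q) the difference h(y) - a^(p^2) h(y - p^2) is
    supported on the residues smaller than p^2.  Applying to the relation above, for every
    eta, the difference operator which localizes h(x eta) leaves only terms coming from
    coincidences c' eta + p^2 sum_I eta' = c + p^2 sum_I0 eta' mod q with 0 < c' < p^2; for N
    large these are identities between roots of unity in O, hence in C.  When I0 is the set
    of roots with positive imaginary part, comparing imaginary parts only leaves eta = 1
    and eta = -1, whence a^(2 p^2 - 2 c) = psi(-1) mod pi for c = 1 + p and c = 1 + 2p, so
    that a = -1 and psi(-1) = 1.  Conversely, if a = -1 and psi(-1) = 1 mod pi, the terms of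
    index k and q - k of M_N cancel mod pi. *)

Require Import Defs.
From HB Require Import structures.
From mathcomp Require Import all_boot all_order all_algebra all_solvable all_field.
From mathcomp Require Import zify ring.
Import GRing.Theory Num.Theory Order.TTheory.
Local Open Scope ring_scope.

(** * Divisibility and p-th powers *)

Section Divisibility.

Context {R : comNzRingType}.
Implicit Types x y z d : R.

Lemma dvdr_refl d : dvdr d d.
Proof. by exists 1; rewrite mulr1. Qed.

Lemma dvdr0 d : dvdr d 0.
Proof. by exists 0; rewrite mulr0. Qed.

Lemma dvdr_mulr d x y : dvdr d x -> dvdr d (x * y).
Proof. by case=> z ->; exists (z * y); rewrite mulrA. Qed.

Lemma dvdr_mull d x y : dvdr d y -> dvdr d (x * y).
Proof. by rewrite mulrC; apply: dvdr_mulr. Qed.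

Lemma dvdr_add d x y : dvdr d x -> dvdr d y -> dvdr d (x + y).
Proof. by move=> [z ->] [t ->]; exists (z + t); rewrite mulrDr. Qed.

Lemma dvdr_opp d x : dvdr d x -> dvdr d (- x).
Proof. by case=> z ->; exists (- z); rewrite mulrN. Qed.

Lemma dvdr_sub d x y : dvdr d x -> dvdr d y -> dvdr d (x - y).
Proof. by move=> dx dy; apply: dvdr_add => //; apply: dvdr_opp. Qed.

Lemma dvdr_sum d (I : Type) (r : seq I) (P : pred I) (f : I -> R) :
  (forall i, P i -> dvdr d (f i)) -> dvdr d (\sum_(i <- r | P i) f i).
Proof.
move=> df; apply: (big_ind (dvdr d)) => //; first exact: dvdr0.
exact: dvdr_add.
Qed.

Lemma dvdr_trans d x y : dvdr d x -> dvdr x y -> dvdr d y.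
Proof. by move=> dx [z ->]; apply: dvdr_mulr. Qed.

Lemma dvdr_pow d m k : (m <= k)%N -> dvdr (d ^+ m) (d ^+ k).
Proof. by move=> /subnKC <-; exists (d ^+ (k - m)); rewrite exprD. Qed.

Lemma dvdr_subX d x y k : dvdr d (x - y) -> dvdr d (x ^+ k - y ^+ k).
Proof. by rewrite subrXX; apply: dvdr_mulr. Qed.

Lemma dvdr_sub_trans d x y z :
  dvdr d (x - y) -> dvdr d (y - z) -> dvdr d (x - z).
Proof. by move=> dxy dyz; rewrite -(subrKA y); apply: dvdr_add. Qed.

Lemma dvdr_subC d x y : dvdr d (x - y) -> dvdr d (y - x).
Proof. by rewrite -opprB => /dvdr_opp; rewrite opprK. Qed.

Lemma natr_dvd p k : (p %| k)%N -> dvdr p%:R (k%:R : R).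
Proof. by case/dvdnP=> z ->; exists z%:R; rewrite natrM mulrC. Qed.

Lemma natr_eqmod p k l : k = l %[mod p] -> dvdr p%:R (k%:R - l%:R : R).
Proof.
move=> e; wlog le_lk : k l e / (l <= k)%N.
  by case/orP: (leq_total l k) => h hw; [apply: hw | apply/dvdr_subC/hw].
by rewrite -natrB //; apply: natr_dvd; rewrite -eqn_mod_dvd //; apply/eqP.
Qed.

Lemma expr_prime_add p x y :
  prime p -> dvdr p%:R ((x + y) ^+ p - (x ^+ p + y ^+ p)).
Proof.
move=> p_pr; have p0 := prime_gt0 p_pr.
rewrite exprDn -(prednK p0) big_ord_recr big_ord_recl /= (prednK p0).
rewrite subnn subn0 binn bin0 !mulr1n !expr0 mul1r mulr1.
have -> (u v s : R) : u + s + v - (u + v) = s by ring.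
apply: dvdr_sum => i _; rewrite /bump /= add1n -[_ *+ _ in X in dvdr _ X]mulr_natr.
apply: dvdr_mull.
by apply: natr_dvd; apply: prime_dvd_bin; have := ltn_ord i; lia.
Qed.

Lemma expr_primeX_add p x y N :
  prime p -> dvdr p%:R ((x + y) ^+ (p ^ N) - (x ^+ (p ^ N) + y ^+ (p ^ N))).
Proof.
move=> p_pr; elim: N => [|N IH]; first by rewrite subrr; apply: dvdr0.
rewrite !expnSr !exprM; apply: dvdr_sub_trans (expr_prime_add _ _ _ p_pr).
exact: dvdr_subX.
Qed.

(** Expand (y + d^(k+1) z)^p: in the linear term the coefficient p supplies the extra factor d, and
    the later terms already contain d^(2(k+1)). *)
Lemma dvdr_subXp p d x y k :
    prime p -> dvdr d p%:R -> dvdr (d ^+ k.+1) (x - y) ->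
  dvdr (d ^+ k.+2) (x ^+ p - y ^+ p).
Proof.
case: p => // p p_pr dp [z e]; have -> : x = y + d ^+ k.+1 * z by rewrite -e; ring.
have p1 := prime_gt1 p_pr.
rewrite exprDn big_ord_recl subn0 bin0 expr0 mulr1 mulr1n addrC addKr.
apply: dvdr_sum => i _; rewrite /bump /= exprMn -exprM.
case: (posnP i) => [->|i_gt0]; last first.
  rewrite -mulrnAr -mulrnAr; apply/dvdr_mull/dvdr_mulr/dvdr_pow.
  by rewrite mulnDr muln1 -addn1 leq_add2l muln_gt0.
rewrite bin1 -[_ *+ p.+1]mulr_natr; case: dp => v ->.
by exists (y ^+ (p.+1 - (1 + 0)) * z * v); rewrite muln1 [d ^+ k.+2]exprS; ring.
Qed.

Lemma dvdr_subXpX p d x y N :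
    prime p -> dvdr d p%:R -> dvdr d (x - y) ->
  dvdr (d ^+ N.+1) (x ^+ (p ^ N) - y ^+ (p ^ N)).
Proof.
move=> p_pr dp dxy; elim: N => [|N IH]; first by rewrite expr1.
by rewrite expnSr !exprM; apply: dvdr_subXp.
Qed.

End Divisibility.

(** * Principal units modulo p^N *)

Lemma expr_expp_pred (R : pzRingType) (p N : nat) (x : R) :
  (0 < p)%N -> x ^+ p.-1 = 1 -> x ^+ (p ^ N) = x.
Proof.
move=> p_gt0 x1; elim: N => [|N IH]; first by rewrite expr1.
by rewrite expnSr exprM IH -(prednK p_gt0) exprS x1 mulr1.
Qed.

Section PrincipalUnits.

Context (p : nat).
Hypothesis (p_pr : prime p) (p_gt2 : (2 < p)%N).

Lemma dvdr_natP (d k l : nat) :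
  dvdr (d%:R : int) (k%:R - l%:R) <-> k = l %[mod d].
Proof.
split=> [[z e]|e]; last exact/natr_eqmod.
apply/eqP; rewrite -eqz_nat -!modz_nat eqz_mod_dvd; apply/dvdzP; exists z.
by rewrite mulrC; move: e; rewrite !natz.
Qed.

(** Both k and l are fixed modulo p^(N+1) by the p^N-th power, which turns a congruence modulo p
    into one modulo p^(N+1). *)
Lemma eqmod_nroot (N k l : nat) :
    k ^ p.-1 = 1 %[mod p ^ N.+1] -> l ^ p.-1 = 1 %[mod p ^ N.+1] ->
  k = l %[mod p] -> k = l %[mod p ^ N.+1].
Proof.
have p_gt0 := prime_gt0 p_pr.
have root j m : m ^ p.-1 = 1 %[mod p ^ N.+1] -> m ^ (p ^ j) = m %[mod p ^ N.+1].
  move=> m1; elim: j => [|j IH]; first by rewrite expn1.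
  have mp : (m ^ p = m * m ^ p.-1)%N by rewrite -expnS prednK.
  by rewrite expnSr expnM -modnXm IH modnXm mp -modnMmr m1 modnMmr muln1.
move=> k1 l1 /dvdr_natP kl; rewrite -(root N _ k1) -(root N _ l1).
apply/dvdr_natP; rewrite !natrX.
by apply: dvdr_subXpX => //; apply: dvdr_refl.
Qed.

Lemma expr1D_sq (R : comNzRingType) (z : R) l :
  dvdr (z ^+ 2) ((1 + z) ^+ l - (1 + l%:R * z)).
Proof.
elim: l => [|l [u e]]; first by exists 0; rewrite expr0; ring.
exists (u * (1 + z) + l%:R).
have {}e : (1 + z) ^+ l = 1 + l%:R * z + z ^+ 2 * u by rewrite -e; ring.
by rewrite exprS e mulrS; ring.
Qed.

Notation P := (p%:R : int).

(** In the binomial expansion the linear term is p^(N+2); each middle term gains a factor p from its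
    binomial coefficient, and the last one, p^(p(N+1)), is small because p > 2. *)
Lemma expr1p_step N :
  dvdr (P ^+ N.+3) ((1 + P ^+ N.+1) ^+ p - (1 + P ^+ N.+2)).
Proof.
rewrite exprDn; move: p_gt2 (p_pr); case: (p) => // -[] // p' p'_gt p'_pr.
rewrite big_ord_recl big_ord_recl /= subn0 bin0 expr0 mulr1n mulr1 expr1n.
rewrite /bump addn0 bin1 expr1n mul1r expr1 -[_ ^+ _ *+ _]mulr_natl -exprS.
rewrite addrA [X in dvdr _ X]addrC addKr.
apply: dvdr_sum => i _; rewrite /= expr1n mul1r -exprM -[_ *+ 'C(_, _)]mulr_natr.
case: (ltnP i p') => hi.
  rewrite [_ ^+ N.+3]exprSr.
  have [z ->] : dvdr p'.+2%:R ('C(p'.+2, 1 + (1 + i))%:R : int).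
    by apply: natr_dvd; apply: prime_dvd_bin => //; lia.
  have [u ->] : dvdr (p'.+2%:R ^+ N.+2 : int) (p'.+2%:R ^+ (N.+1 * (1 + (1 + i)))).
    by apply: dvdr_pow; rewrite !mulnDr; nia.
  by exists (u * z); ring.
apply/dvdr_mulr/dvdr_pow; have := p'_gt; nia.
Qed.

Lemma expr1p_pexp N : dvdr (P ^+ N.+2) ((1 + P) ^+ (p ^ N) - (1 + P ^+ N.+1)).
Proof.
elim: N => [|N IH]; first by rewrite expr1 subrr; apply: dvdr0.
rewrite expnSr exprM; apply: dvdr_sub_trans (expr1p_step N).
by apply: dvdr_subXp => //; apply: dvdr_refl.
Qed.

Lemma expr1p_pexpM N l :
  dvdr (P ^+ N.+2) ((1 + P) ^+ (p ^ N * l) - (1 + l%:R * P ^+ N.+1)).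
Proof.
rewrite exprM; apply: dvdr_sub_trans (dvdr_subX _ _ _ _ (expr1p_pexp N)) _.
apply: dvdr_trans (expr1D_sq _ _ l); rewrite -exprM; apply: dvdr_pow; lia.
Qed.

Lemma expr1p_mod e : dvdr P ((1 + P) ^+ e - 1).
Proof. by rewrite -[X in _ - X](expr1n _ e); apply: dvdr_subX; exists 1; ring. Qed.

(** The exponent is lifted one p-adic digit at a time. *)
Lemma log1p_exists N (x : int) : dvdr P (x - 1) ->
  exists e : nat, dvdr (P ^+ N.+1) ((1 + P) ^+ e - x).
Proof.
move=> x1; elim: N => [|N [e [y E]]]; first by exists 0%N; apply: dvdr_subC.
have p0 : P != 0 by have := prime_gt0 p_pr; lia.
(* Multiplying by (1 + p)^(p^N z) adds z p^(N+1) modulo p^(N+2); the error being y p^(N+1), the next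
   digit is -y mod p. *)
pose z := `|((- y) %% P)%Z|%N.
have zP : dvdr P (y + z%:R).
  exists (- ((- y) %/ P)%Z).
  have := divz_eq (- y) P; rewrite /z; have := modz_ge0 (- y) p0.
  case: ((- y) %% P)%Z => // u _ /=; rewrite !natz; move: (_ %/ _)%Z => v h.
  by rewrite -[y]opprK h opprD subrK mulrN mulrC.
clearbody z; exists (e + p ^ N * z)%N; rewrite exprD.
have h1 := expr1p_pexpM N z.
have h2 : dvdr (P ^+ N.+2) (((1 + P) ^+ e - 1) * (z%:R * P ^+ N.+1)).
  by have [u ->] := expr1p_mod e; exists (u * z%:R); rewrite [P ^+ N.+2]exprS; ring.
have h3 : dvdr (P ^+ N.+2) (P ^+ N.+1 * (y + z%:R)).
  by have [u ->] := zP; exists u; rewrite [P ^+ N.+2]exprSr; ring.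
have := dvdr_add _ _ _ (dvdr_add _ _ _ (dvdr_mull _ ((1 + P) ^+ e) _ h1) h2) h3.
by congr dvdr; rewrite [_ * (y + _)]mulrDr -E; ring.
Qed.

(** For k = p^N l, (1 + p)^k - 1 is l p^(N+1) modulo p^(N+2), so one more power of p forces p to
    divide l. *)
Lemma log1p_unique N (k : nat) : dvdr (P ^+ N.+1) ((1 + P) ^+ k - 1) -> (p ^ N %| k)%N.
Proof.
elim: N => [|N IH]; first by rewrite expn0 dvd1n.
move=> h; have /IH /dvdnP[l e] : dvdr (P ^+ N.+1) ((1 + P) ^+ k - 1).
  exact: dvdr_trans (dvdr_pow _ _ _ (leqnSn _)) h.
rewrite e mulnC in h *; have := dvdr_sub _ _ _ h (expr1p_pexpM N l).
rewrite (_ : _ - 1 - _ = l%:R * P ^+ N.+1); last by ring.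
move=> [z] /esym /eqP.
rewrite exprSr -mulrA mulrC -subr_eq0 -mulrBl mulf_eq0 expf_eq0 /=.
have -> /= : P == 0 = false by have := prime_gt0 p_pr; lia.
rewrite orbF subr_eq0 => /eqP h2; rewrite expnSr dvdn_pmul2l ?expn_gt0 ?prime_gt0 //.
have : (P %| l%:R)%Z by apply/dvdzP; exists z; rewrite -h2 mulrC.
by rewrite !natz.
Qed.

End PrincipalUnits.

(** * Integral relations between roots of unity *)

(** X^n - 1 is the product of the cyclotomic polynomials of index d dividing n; the one vanishing at
    x gives x^d = 1, hence d = n. *)
Lemma root_Cyclotomic_prim (O : idomainType) n (x : O) :
  n.-primitive_root x -> root (map_poly intr (Cyclotomic n)) x.
Proof.
move=> x_prim; have n_gt0 := prim_order_gt0 x_prim.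
have := congr1 (fun q => (map_poly intr q : {poly O}).[x]) (prod_Cyclotomic n_gt0).
rewrite /= rmorphB rmorph1 /= map_polyXn rmorph_prod /= !hornerE horner_prod.
rewrite (prim_expr_order x_prim) subrr => /eqP.
rewrite prodf_seq_eq0 => /hasP[d]; rewrite -dvdn_divisors // => d_n /= d_root.
suff -> : n = d by [].
have d_gt0 : (0 < d)%N := dvdn_gt0 n_gt0 d_n.
apply/eqP; rewrite eqn_dvd d_n andbT (prim_order_dvd x_prim).
have := congr1 (fun q => (map_poly intr q : {poly O}).[x]) (prod_Cyclotomic d_gt0).
rewrite /= rmorphB rmorph1 /= map_polyXn rmorph_prod /= !hornerE horner_prod.
move/esym/eqP; rewrite (big_rem d) /=; last by rewrite -dvdn_divisors.
by rewrite (eqP d_root) mul0r subr_eq0.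
Qed.

(** A relation at [x] prevents P from being coprime to the n-th cyclotomic polynomial, which is
    irreducible over the rationals and so divides P. *)
Lemma int_relation_transfer (O : idomainType) n (x : O) (z : algC) (P : {poly int}) :
    (forall m : nat, (0 < m)%N -> m%:R != 0 :> O) ->
    n.-primitive_root x -> n.-primitive_root z ->
  root (map_poly intr P) x -> root (map_poly intr P) z.
Proof.
move=> char0 x_prim z_prim Px.
pose QC := map_poly (ratr : rat -> algC); pose ZQ := map_poly (intr : int -> rat).
have ZC q : map_poly intr q = QC (ZQ q) :> {poly algC}.
  by rewrite /QC /ZQ -map_poly_comp; apply: eq_map_poly => m /=; rewrite ratr_int.
rewrite ZC.
have int0 (m : int) : (m%:~R == 0 :> O) = (m == 0).
  case: m => m; last by rewrite NegzE mulrNz oppr_eq0 oppr_eq0 (negbTE (char0 _ _)).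
  by case: m => [|m]; rewrite ?eqxx // (negbTE (char0 _ _)).
have not_coprime : ~~ coprimep (ZQ P) (ZQ (Cyclotomic n)).
  apply/negP => /Bezout_eq1_coprimepP[[u v] /= uv].
  have [U [b b0 uE]] := rat_poly_scale u; have [V [d d0 vE]] := rat_poly_scale v.
  have UE : ZQ U = b%:~R%:P * u by rewrite uE mul_polyC scalerA mulfV ?intr_eq0 ?scale1r.
  have VE : ZQ V = d%:~R%:P * v by rewrite vE mul_polyC scalerA mulfV ?intr_eq0 ?scale1r.
  (* Bezout with denominators cleared: evaluation at [x] would kill the nonzero integer b d in O,
     against characteristic zero. *)
  have : d%:P * U * P + b%:P * V * Cyclotomic n = (b * d)%:P.
    apply: (@map_inj_poly _ _ (intr : int -> rat) intr_inj (erefl _)).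
    rewrite !rmorphD !rmorphM /= !map_polyC /= -/(ZQ U) -/(ZQ V) -/(ZQ P) -/(ZQ _) UE VE.
    by rewrite -[RHS]mulr1 -uv; ring.
  move=> /(congr1 (fun q => (map_poly intr q : {poly O}).[x])) /=.
  rewrite !rmorphD !rmorphM /= !map_polyC /= !hornerE (eqP Px).
  rewrite (eqP (root_Cyclotomic_prim _ _ _ x_prim)) !mulr0 addr0 => /esym/eqP.
  by rewrite -rmorphM int0 mulf_eq0 (negbTE b0) (negbTE d0).
(* A common complex root y is a primitive n-th root of unity; its minimal polynomial divides P and
   also vanishes at [z]. *)
have : ~~ coprimep (QC (ZQ P)) (QC (ZQ (Cyclotomic n))) by rewrite coprimep_map.
rewrite /coprimep => /closed_rootP[y]; rewrite root_gcd -[QC (ZQ (Cyclotomic n))]ZC.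
rewrite (Cintr_Cyclotomic z_prim) root_cyclotomic // => /andP[Py y_prim].
have [q [min_q _] min_qP] := minCpolyP y.
rewrite min_qP in Py; have [r ->] := dvdpP _ _ Py.
rewrite /QC rmorphM rootM; apply/orP; right; rewrite /= -min_q.
rewrite (minCpoly_cyclotomic y_prim) -(Cintr_Cyclotomic y_prim).
by rewrite (Cintr_Cyclotomic z_prim) root_cyclotomic.
Qed.

Lemma prim_root_half (R : idomainType) n s (x : R) :
  n = s.*2 -> (0 < s)%N -> n.-primitive_root x -> x ^+ s = -1.
Proof.
move=> n2s s_gt0 x_prim; have := prim_expr_order x_prim; rewrite n2s -muln2 exprM => /eqP.
rewrite sqrf_eq1 -(prim_order_dvd x_prim) n2s => /orP[|/eqP //].
by move=> /(dvdn_leq s_gt0); lia.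
Qed.

(** * Imaginary parts of sums of roots of unity *)

Section UnitCircle.

Context (n s : nat) (z : algC).
Hypotheses (n2s : n = s.*2) (s_gt0 : (0 < s)%N) (z_prim : n.-primitive_root z).

(** A real number of absolute value 1 has square 1, so n = 2s divides 2i. *)
Lemma Im_prim_root_eq0 i : 'Im (z ^+ i) = 0 -> (s %| i)%N.
Proof.
move=> /Creal_ImP z_real; have z1 : `|z| = 1.
  apply/eqP; rewrite -(pexpr_eq1 (prim_order_gt0 z_prim)) ?normr_ge0 //.
  by rewrite -normrX prim_expr_order // normr1.
have := real_normK z_real; rewrite normrX z1 !expr1n -exprM => /esym/eqP.
by rewrite -(prim_order_dvd z_prim) n2s -muln2 dvdn_pmul2r.
Qed.

Let l (i : 'I_n) := 'Im (z ^+ i).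
Let I0 := [set i : 'I_n | 0 < l i].

(* Taking imaginary parts, every summand of the difference of the two sides is
   nonnegative, so all of them vanish. *)
Lemma root_sum_extremal (A c c' : nat) (o0 os j : 'I_n) (I : {set 'I_n}) :
    o0 = 0%N :> nat -> os = s :> nat -> (0 < c)%N -> (0 < c' < A)%N -> j \notin I ->
    c'%:R * z ^+ j + A%:R * (\sum_(i in I) z ^+ i) =
      c%:R + A%:R * (\sum_(i in I0) z ^+ i) ->
  (j = o0 /\ I = I0) \/ (j = os /\ I = o0 |: I0).
Proof.
move=> o0E osE c_gt0 /andP[c'_gt0 c'_lt] jI rel.
have Im_nat (m : nat) (y : algC) : 'Im (m%:R * y) = m%:R * 'Im y.
  by rewrite ImMl ?realn.
have l_real i : l i \is Num.real by apply: Creal_Im.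
(* Coefficient of z^i in the right side minus the left side, the real constant c apart. *)
pose e i : algC := A%:R * (i \in I0)%:R - A%:R * (i \in I)%:R - c'%:R * (i == j)%:R.
have sum0 : \sum_(i < n) e i * l i = 0.
  have : 'Im (c'%:R * z ^+ j + A%:R * (\sum_(i in I) z ^+ i)) =
         'Im (c%:R + A%:R * (\sum_(i in I0) z ^+ i)) by rewrite rel.
  rewrite !raddfD /= !Im_nat !raddf_sum /= -[c%:R]mulr1 Im_nat.
  rewrite (Creal_ImP 1 _) ?real1 // mulr0 add0r => h.
  under eq_bigr => i _ do rewrite !mulrBl -!mulrA.
  rewrite !sumrB -!mulr_sumr.
  have sumE (B : {set 'I_n}) : \sum_(i < n) (i \in B)%:R * l i = \sum_(i in B) l i.
    by rewrite [RHS]big_mkcond; apply: eq_bigr => i _; case: ifP; rewrite ?mul1r ?mul0r.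
  have deltaE : \sum_(i < n) (i == j)%:R * l i = l j.
    rewrite (bigD1 j) //= eqxx mul1r big1 ?addr0 // => i /negbTE ->.
    by rewrite mul0r.
  by rewrite !sumE deltaE -h addrK subrr.
have A_gt : (c'%:R : algC) < A%:R by rewrite ltr_nat.
(* Where [l i] is positive, [e i] is A, 0 or A - c', as j is not in I and c' < A; where [l i] is
   negative, [e i] is at most 0. *)
have term_ge0 i : 0 <= e i * l i.
  have /= := real_ltgt0P (l_real i); rewrite /e inE.
  case=> [li|li|->]; last by rewrite mulr0.
  - rewrite mulr1; case: (boolP (i \in I)) => iI.
      have -> : i == j = false by apply: contraNF jI => /eqP <-.
      by rewrite mulr1 subrr mulr0 subr0 mul0r.
    apply: mulr_ge0 (ltW li); rewrite mulr0 subr0 subr_ge0.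
    by case: (i == j); rewrite ?mulr1 ?mulr0 ?ler0n // ltW.
  - rewrite mulr0 sub0r -opprD mulNr -mulrN mulr_ge0 ?oppr_ge0 ?(ltW li) //.
    by rewrite addr_ge0 // mulr_ge0 ?ler0n.
have term0 i : e i * l i = 0.
  by apply: (psumr_eq0P (P := predT) (F := fun i => e i * l i)) => // k _.
have pos_mem i : 0 < l i -> i \in I.
  move=> li; apply: contraT => iI; have /eqP := term0 i.
  rewrite mulf_eq0 (gt_eqF li) orbF /e inE li (negbTE iI) mulr1 mulr0 subr0.
  case: (i == j); rewrite ?mulr1 ?mulr0 ?subr0 ?subr_eq0.
    by rewrite gt_eqF.
  by rewrite pnatr_eq0; case: (A) c'_lt.
have neg_mem i : l i < 0 -> (i \notin I) && (i != j).
  move=> li; have /eqP := term0 i.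
  rewrite mulf_eq0 (lt_eqF li) orbF /e inE (lt_gtF li) mulr0 sub0r -opprD oppr_eq0.
  rewrite paddr_eq0 ?mulr_ge0 ?ler0n // !mulf_eq0 !pnatr_eq0 !eqb0.
  have -> : A == 0%N = false by apply/negbTE; lia.
  by have -> : c' == 0%N = false by apply/negbTE; lia.
have zero_l i : l i = 0 -> i = o0 \/ i = os.
  move=> /Im_prim_root_eq0 /dvdnP[k ik]; have hk := ltn_ord i.
  have k2 : (k < 2)%N by rewrite ik [X in (_ < X)%N]n2s -mul2n ltn_pmul2r in hk.
  case: k k2 ik {hk} => [|[]] // _ ik; [left|right]; apply: val_inj => /=.
    by rewrite ik o0E.
  by rewrite ik osE mul1n.
have zs := prim_root_half _ _ _ _ n2s s_gt0 z_prim.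
have lj : l j = 0.
  have := real_ltgt0P (l_real j); case=> // [/pos_mem|/neg_mem /andP[_ /eqP] //].
  by rewrite (negbTE jI).
have IE i : i \in I -> i != o0 -> i != os -> i \in I0.
  move=> iI /eqP i0 /eqP is'; rewrite inE.
  have := real_ltgt0P (l_real i); case=> // [/neg_mem /andP[]|/zero_l []] //.
  by rewrite iI.
have l0 : l o0 = 0 by rewrite /l o0E (Creal_ImP 1 _) ?real1.
have ls : l os = 0 by rewrite /l osE zs (Creal_ImP (-1) _) ?realN ?real1.
have sub0 : I0 \subset I by apply/subsetP => i; rewrite inE; apply: pos_mem.
have [] := zero_l _ lj => jE; [left|right]; split=> //; rewrite jE in jI.
  case: (boolP (os \in I)) => osI; last first.
    apply/eqP; rewrite eqEsubset sub0 andbT; apply/subsetP => i iI.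
    by apply: IE => //; [apply: contraNneq jI => <-|apply: contraNneq osI => <-].
  have IE' : I = os |: I0.
    apply/eqP; rewrite eqEsubset subUset sub1set osI sub0 !andbT.
    apply/subsetP => i iI; rewrite in_setU1; case: eqVneq => //= ios.
    by apply: IE => //; apply: contraNneq jI => <-.
  (* The extra root -1 would leave c' - A = c, impossible for c' < A and c > 0. *)
  move: rel; rewrite IE' big_setU1 ?inE ?ls ?ltxx // jE o0E osE zs expr0 mulr1.
  rewrite mulrDr mulrN1 addrA => /addIr /eqP.
  by rewrite subr_eq -natrD eqr_nat; lia.
case: (boolP (o0 \in I)) => o0I.
  apply/eqP; rewrite eqEsubset subUset sub1set o0I sub0 !andbT.
  apply/subsetP => i iI; rewrite in_setU1; case: eqVneq => //= io0.
  by apply: IE => //; apply: contraNneq jI => <-.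
have IE' : I = I0.
  apply/eqP; rewrite eqEsubset sub0 andbT; apply/subsetP => i iI.
  by apply: IE => //; [apply: contraNneq o0I => <-|apply: contraNneq jI => <-].
move: rel; rewrite IE' jE osE zs mulrN1 => /addIr /eqP.
by rewrite eq_sym -addr_eq0 -natrD pnatr_eq0; lia.
Qed.

End UnitCircle.

(** * Discrete valuation rings over the p-adic integers *)

Section Uniformizer.

Context (p : nat) (O : idomainType) (pi : O).
Hypotheses (p_pr : prime p) (p_gt2 : (2 < p)%N) (O_padic : is_padic_integers p pi).

Lemma padic_natr_neq0 (m : nat) : (0 < m)%N -> m%:R != 0 :> O.
Proof. by case: O_padic => h _; apply: h. Qed.

Lemma dvdr_pi_p : dvdr pi (p%:R : O).
Proof. by case: O_padic => _ [_ [_ [_ [h _]]]]. Qed.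

Lemma pi_factor (x : O) : x != 0 -> exists (k : nat) (u : O), u \in GRing.unit /\ x = u * pi ^+ k.
Proof. by case: O_padic => _ [_ [_ [h _]]]; apply: h. Qed.

Lemma unit_not_dvdr_pi (x : O) : x \in GRing.unit -> ~ dvdr pi x.
Proof.
case: O_padic => _ [_ [/negP pi_nunit _]] xu [z e]; apply: pi_nunit.
by move: xu; rewrite e unitrM => /andP[].
Qed.

Lemma unit_or_dvdr_pi (x : O) : x \in GRing.unit \/ dvdr pi x.
Proof.
have [->|/pi_factor[[|k] [u [uu ->]]]] := eqVneq x 0; first by right; apply: dvdr0.
  by left; rewrite mulr1.
by right; rewrite exprS mulrCA; apply/dvdr_mulr/dvdr_refl.
Qed.

Lemma dvdr_pi_unitl (u x : O) : u \in GRing.unit -> dvdr pi (u * x) -> dvdr pi x.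
Proof. by move=> uu /(dvdr_mull _ u^-1); rewrite mulKr. Qed.

Lemma dvdr_pi_prime (x y : O) : dvdr pi (x * y) -> dvdr pi x \/ dvdr pi y.
Proof.
have [ux|] := unit_or_dvdr_pi x; last by left.
by move/(dvdr_pi_unitl _ _ ux); right.
Qed.

Lemma dvdr_pi_expr (x : O) k : dvdr pi (x ^+ k) -> dvdr pi x.
Proof.
elim: k => [|k IH]; last by rewrite exprS => /dvdr_pi_prime[].
by move/unit_not_dvdr_pi; rewrite unitr1 => /(_ isT).
Qed.

Lemma dvdr_pi_pow_bound (x : O) : x != 0 -> exists N, ~ dvdr (pi ^+ N) x.
Proof.
case: (O_padic) => _ [pi0 _] /pi_factor[k [u [uu ->]]]; exists k.+1 => -[z].
rewrite exprSr mulrC -mulrA => /(mulfI (expf_neq0 k pi0)) e.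
by apply: (unit_not_dvdr_pi _ uu); exists z.
Qed.

(** Turns congruences modulo a high power of [pi] into exact equalities, with one bound for finitely
    many candidates. *)
Lemma dvdr_pi_pow_eq0_unif (T : finType) (f : T -> O) :
  exists N, forall M t, (N <= M)%N -> dvdr (pi ^+ M) (f t) -> f t = 0.
Proof.
have /fin_all_exists[N hN] (t : T) : exists N, dvdr (pi ^+ N) (f t) -> f t = 0.
  have [->|/dvdr_pi_pow_bound[N hN]] := eqVneq (f t) 0; first by exists 0%N.
  by exists N.
exists (\max_t N t) => M t le_NM ft; apply: hN; apply: dvdr_trans ft.
by apply: dvdr_pow; apply: leq_trans le_NM; apply: leq_bigmax.
Qed.

Lemma dvdr_pi_natr (m : nat) : dvdr pi (m%:R : O) -> (p %| m)%N.
Proof.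
move=> pi_m; apply: contraT; rewrite -prime_coprime // => /coprimeP.
move=> /(_ (prime_gt0 p_pr)) [[u v] /= e]; case: (unit_not_dvdr_pi _ (unitr1 O)).
have -> : (1 : O) = (u * p)%:R - (v * m)%:R by rewrite -natrB ?e //; lia.
by rewrite !natrM; apply: dvdr_sub; apply: dvdr_mull => //; apply: dvdr_pi_p.
Qed.

Lemma natr_unit (m : nat) : ~~ (p %| m)%N -> (m%:R : O) \in GRing.unit.
Proof. by have [//|/dvdr_pi_natr ->] := unit_or_dvdr_pi (m%:R : O). Qed.

(* A (p-1)-th root of unity is fixed by x |-> x^(p^N), which contracts the
   pi-adic distance. *)
Lemma nroot_pi_inj (x y : O) :
  x ^+ p.-1 = 1 -> y ^+ p.-1 = 1 -> dvdr pi (x - y) -> x = y.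
Proof.
move=> x1 y1 xy; apply/eqP; rewrite -subr_eq0; apply: contraT.
move=> /dvdr_pi_pow_bound[N]; case; apply: dvdr_trans (dvdr_pow _ _ _ (leqnSn N)) _.
have p_gt0 := prime_gt0 p_pr.
rewrite -[x](expr_expp_pred _ p N) // -[y](expr_expp_pred _ p N) //.
by apply: dvdr_subXpX => //; apply: dvdr_pi_p.
Qed.

(** Modulo p, (x - 1)^(p^N) equals x^(p^N) - 1, and [pi] is prime. *)
Lemma dvdr_pi_Xpn_sub1 (x : O) N : dvdr pi (x ^+ (p ^ N) - 1) -> dvdr pi (x - 1).
Proof.
move=> h; apply: (dvdr_pi_expr _ (p ^ N)).
have := dvdr_trans _ _ _ dvdr_pi_p (expr_primeX_add _ (x - 1) 1 N p_pr).
rewrite subrK expr1n => h'.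
rewrite (_ : _ ^+ _ = x ^+ (p ^ N) - 1 - (x ^+ (p ^ N) - ((x - 1) ^+ (p ^ N) + 1))).
  exact: dvdr_sub.
by ring.
Qed.

End Uniformizer.

(** * The difference operators *)

Lemma big_set_split (V : nmodType) (T : finType) (j : T) (F : {set T} -> V) :
  \sum_(I : {set T}) F I = \sum_(I : {set T} | j \notin I) (F I + F (j |: I)).
Proof.
rewrite (bigID (fun I : {set T} => j \in I)) /= addrC big_split /=; congr (_ + _).
rewrite (reindex_onto (fun I : {set T} => j |: I) (fun I => I :\ j)) /=; last first.
  by move=> I jI; rewrite setD1K.
apply: eq_bigl => I; rewrite setU11 /=; apply/eqP/idP => [<-|jI].
  by rewrite setD11.
by rewrite setU1K.
Qed.

(** Either the residue of y just grows by A and the two terms cancel, or the sum wraps past q and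
    lands below A; the wrap produces the factor 1 - a^q. *)
Lemma shift_residue (O : comNzRingType) (a : O) (q A x y : nat) :
    (0 < q)%N -> (A <= q)%N -> x = y + A %[mod q] ->
  a ^+ (x %% q) - a ^+ A * a ^+ (y %% q) =
    (1 - a ^+ q) * (if (x %% q < A)%N then a ^+ (x %% q) else 0).
Proof.
move=> q_gt0 A_q; rewrite -modnDml => xy; rewrite xy -exprD [(A + _)%N]addnC.
have := ltn_pmod y q_gt0; move: (y %% q)%N => r r_q; case: (ltnP (r + A) q) => rA.
  by rewrite modn_small // ltnNge leq_addl /= mulr0 subrr.
have -> : ((r + A) %% q = r + A - q)%N.
  by rewrite -[in LHS](subnK rA) modnDr modn_small //; lia.
rewrite ifT; last by lia.
by rewrite mulrBl mul1r -exprD subnKC.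
Qed.

Lemma pred_prime_half p : prime p -> (2 < p)%N -> p.-1 = p.-1./2.*2.
Proof. by case/even_prime => [-> //|]; case: p => //= m /negbTE; lia. Qed.

Lemma pred_prime_half_gt0 p : prime p -> (2 < p)%N -> (0 < p.-1./2)%N.
Proof. by move=> p_pr p_gt2; have := pred_prime_half p p_pr p_gt2; lia. Qed.

Section Convolution.

Context (p : nat) (O : idomainType) (pi : O) (w a : O) (e : nat -> O) (c : nat).
Hypotheses (p_pr : prime p) (p_gt2 : (2 < p)%N) (O_padic : is_padic_integers p pi).
Let n := p.-1.
Let s := n./2.
Context (z : algC) (o0 os : 'I_n).
Hypotheses (w_prim : n.-primitive_root w) (z_prim : n.-primitive_root z).
Hypotheses (o0E : o0 = 0%N :> nat) (osE : os = s :> nat).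
Hypotheses (a_unit : a \in GRing.unit) (c_bd : (0 < c < p ^ 2)%N).
Let I0 := [set i : 'I_n | 0 < 'Im (z ^+ i)].

Let n2s : n = s.*2 := pred_prime_half p p_pr p_gt2.
Let s_gt0 : (0 < s)%N := pred_prime_half_gt0 p p_pr p_gt2.

(* X t I is x - p^2 sum_(i in I) t^i modulo p^N, with x = c + p^2 sum_(i in I0) t^i:
   adding s to the exponent of t changes the sign, as t^s = -1. *)
Let X (t : nat) (I : {set 'I_n}) : nat :=
  (c + p ^ 2 * (\sum_(i in I0) t ^ i) + p ^ 2 * (\sum_(i in I) t ^ (i + s)))%N.

(* For N large, the congruence is an exact relation between the powers of w, which the
   irreducibility of the cyclotomic polynomial carries over to the complex root z. *)
Lemma small_residue_rigidity :
  exists N0, forall (N t c' : nat) (j : 'I_n) (I : {set 'I_n}), (N0 <= N)%N ->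
    dvdr (pi ^+ N) (t%:R - w) -> j \notin I -> (0 < c' < p ^ 2)%N ->
    c' * t ^ j = X t I %[mod p ^ N] ->
  (j = o0 /\ I = I0) \/ (j = os /\ I = o0 |: I0).
Proof.
have n_gt0 : (0 < n)%N := prim_order_gt0 w_prim.
pose P (u : 'I_(p ^ 2) * 'I_n * {set 'I_n}) : {poly int} :=
  (u.1.1)%:R%:P * 'X^(u.1.2) + (p ^ 2)%:R%:P * (\sum_(i in u.2) 'X^i) -
  (c%:R%:P + (p ^ 2)%:R%:P * (\sum_(i in I0) 'X^i)).
have PE (R : comNzRingType) (x : R) u : (map_poly intr (P u)).[x] =
    (u.1.1)%:R * x ^+ u.1.2 + (p ^ 2)%:R * (\sum_(i in u.2) x ^+ i) -
    (c%:R + (p ^ 2)%:R * (\sum_(i in I0) x ^+ i)).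
  rewrite /P !(rmorphD, rmorphN, rmorphM, rmorph_sum) /= !map_polyC /= map_polyXn.
  rewrite !hornerE !horner_sum !rmorph_nat.
  by congr (_ + _ * _ - (_ + _ * _)); apply: eq_bigr => i _; rewrite map_polyXn hornerXn.
have [N0 hN0] := dvdr_pi_pow_eq0_unif _ _ _ O_padic _ (fun u => (map_poly intr (P u)).[w]).
exists N0 => N t c' j I le_N tw jI /andP[c'_gt0 c'_lt] relN.
have := hN0 N (Ordinal c'_lt, j, I) le_N.
rewrite PE /= => rel0.
have /rel0 {}rel0 : dvdr (pi ^+ N) (c'%:R * w ^+ j + (p ^ 2)%:R * \sum_(i in I) w ^+ i -
    (c%:R + (p ^ 2)%:R * \sum_(i in I0) w ^+ i)).
  have tX i : dvdr (pi ^+ N) ((t ^ i)%:R - w ^+ i) by rewrite natrX; apply: dvdr_subX.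
  have rel : dvdr (pi ^+ N) ((c' * t ^ j)%:R - (X t I)%:R).
    apply: dvdr_trans (natr_eqmod _ _ _ relN); rewrite natrX.
    have [v ->] := dvdr_pi_p _ _ _ O_padic; rewrite exprMn.
    exact/dvdr_mulr/dvdr_refl.
  have XE : dvdr (pi ^+ N) ((X t I)%:R - (c%:R + (p ^ 2)%:R * \sum_(i in I0) w ^+ i
      - (p ^ 2)%:R * \sum_(i in I) w ^+ i)).
    rewrite /X !natrD !natrM !natr_sum.
    rewrite (_ : _ - _ = (p ^ 2)%:R * (\sum_(i in I0) ((t ^ i)%:R - w ^+ i)) +
      (p ^ 2)%:R * (\sum_(i in I) ((t ^ (i + s))%:R - w ^+ (i + s)))).
      by apply: dvdr_add; apply/dvdr_mull/dvdr_sum => i _; apply: tX.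
    have -> : \sum_(i in I) ((t ^ (i + s))%:R - w ^+ (i + s)) =
        \sum_(i in I) (t ^ (i + s))%:R + \sum_(i in I) w ^+ i.
      rewrite -big_split; apply: eq_bigr => i _.
      by rewrite /= exprD (prim_root_half _ _ _ _ n2s s_gt0 w_prim) mulrN1 opprK.
    by rewrite sumrB; ring.
  have := dvdr_sub _ _ _ (dvdr_add _ _ _ rel XE) (dvdr_mull _ c'%:R _ (tX j)).
  by congr dvdr; rewrite natrM; ring.
have {}rel0 : root (map_poly intr (P (Ordinal c'_lt, j, I))) w by apply/eqP; rewrite PE.
have /eqP := int_relation_transfer _ _ _ _ _ (padic_natr_neq0 _ _ _ O_padic) w_prim z_prim rel0.
rewrite PE /= => /eqP; rewrite subr_eq0 => /eqP.
apply: (root_sum_extremal _ _ _ n2s s_gt0 z_prim) => //; first by case/andP: c_bd.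
by apply/andP; split.
Qed.

(* The relation is summed over the points X t I with weights (-a^(p^2))^#|I|, which
   composes the difference operators y |-> h(y) - a^(p^2) h(y - p^2 t^j) for all j < n. *)
Lemma orbit_relation_rigidity :
  exists N0, forall N t : nat, (N0 <= N)%N -> (0 < N)%N ->
    (p ^ N.+1 %| t ^ s + 1)%N -> dvdr (pi ^+ N.+1) (t%:R - w) ->
    (forall x, x = c %[mod p ^ 2] ->
      dvdr pi (\sum_(j < n) e j * a ^+ ((x * t ^ (n - j)) %% p ^ N.+1))) ->
  dvdr pi ((1 - a ^+ (p ^ N.+1)) * (e 0%N * a ^+ c - e s * a ^+ (p ^ 2 + (p ^ 2 - c)))).
Proof.
have [N0 rigid] := small_residue_rigidity.
exists N0 => N t le_N N_gt0 + tw +.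
have [q qE] : exists q, q = (p ^ N.+1)%N by exists (p ^ N.+1)%N.
have p_gt0 := prime_gt0 p_pr.
have q_gt0 : (0 < q)%N by rewrite qE expn_gt0 p_gt0.
have p2_q : (p ^ 2 %| q)%N by rewrite qE dvdn_exp2l.
rewrite -qE => ts H.
have p2_le_q : (p ^ 2 <= q)%N := dvdn_leq q_gt0 p2_q.
have [c_gt0 c_lt] := andP c_bd.
pose T : int := t%:R.
have Ts : dvdr (q%:R : int) (T ^+ s + 1) by rewrite -natrX natr1 -addn1; apply: natr_dvd.
have Tn : dvdr (q%:R : int) (T ^+ n - 1).
  have -> : T ^+ n - 1 = (T ^+ s + 1) * (T ^+ s - 1) by rewrite n2s -addnn exprD; ring.
  exact: dvdr_mulr.
have modqP k l : dvdr (q%:R : int) (k%:R - l%:R) -> k = l %[mod q].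
  by move/dvdr_natP.
have XU (j : 'I_n) (I : {set 'I_n}) : j \notin I -> X t (j |: I) = (X t I + p ^ 2 * t ^ (j + s))%N.
  by move=> jI; rewrite /X big_setU1 //= mulnDr addnA [RHS]addnAC.
have Xc I : X t I = c %[mod p ^ 2].
  by rewrite /X -addnA -mulnDr addnC mulnC modnMDl.
(* The points for I and [j |: I] differ by p^2 t^(j+s), which multiplied by t^(n-j) becomes p^2 t^s
   = -p^2 modulo q. *)
have step (j : 'I_n) (I : {set 'I_n}) : j \notin I ->
    X t I * t ^ (n - j) = X t (j |: I) * t ^ (n - j) + p ^ 2 %[mod q].
  move=> jI; apply: modqP; rewrite XU // natrD !natrM natrD natrM !natrX -/T.
  have jn : T ^+ (j + s) * T ^+ (n - j) = T ^+ n * T ^+ s.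
    by rewrite -!exprD; congr (T ^+ _); have := ltn_ord j; lia.
  rewrite (_ : _ - _ = - (p%:R ^+ 2 * ((T ^+ n - 1) * T ^+ s + (T ^+ s + 1)))).
    by apply/dvdr_opp/dvdr_mull/dvdr_add => //; apply: dvdr_mulr.
  by rewrite mulrDl -[_ * _ * T ^+ (n - j)]mulrA jn; ring.
have back (j : 'I_n) (I : {set 'I_n}) : (X t I * t ^ (n - j)) %% q * t ^ j = X t I %[mod q].
  rewrite modnMml -mulnA -expnD subnK; last exact/ltnW.
  apply: modqP; rewrite natrM natrX -/T (_ : _ - _ = (X t I)%:R * (T ^+ n - 1)); last by ring.
  exact: dvdr_mull.
have o0I0 : o0 \notin I0.
  by rewrite inE o0E (Creal_ImP 1 _) ?real1 // ltxx.
pose B := a ^+ (p ^ 2).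
pose h y := a ^+ (y %% q).
(* [g] is [h] restricted to residues below p^2; [G j I] is what the pair of I and [j |: I] leaves
   for the index j. *)
pose g y := if (y %% q < p ^ 2)%N then a ^+ (y %% q) else 0.
pose G (j : 'I_n) (I : {set 'I_n}) :=
  e j * (1 - a ^+ q) * ((- B) ^+ #|I| * g (X t I * t ^ (n - j))%N).
have T0 : dvdr pi (\sum_(I : {set 'I_n}) (- B) ^+ #|I| *
                     \sum_(j < n) e j * h (X t I * t ^ (n - j))%N).
  by apply: dvdr_sum => I _; apply/dvdr_mull/H.
have TE : \sum_(I : {set 'I_n}) (- B) ^+ #|I| * (\sum_(j < n) e j * h (X t I * t ^ (n - j))%N) =
    \sum_(j < n) \sum_(I : {set 'I_n} | j \notin I) G j I.
  under eq_bigr => I _ do rewrite mulr_sumr.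
  rewrite exchange_big; apply: eq_bigr => j _.
  rewrite (big_set_split _ _ j); apply: eq_bigr => I jI.
  rewrite cardsU1 jI exprS /G /g [RHS]mulrACA.
  rewrite -(shift_residue _ _ _ _ _ _ q_gt0 p2_le_q (step _ _ jI)) -/B -/(h _) -/(h _).
  by ring.
have G0 (j : 'I_n) (I : {set 'I_n}) : j \notin I -> G j I != 0 ->
    (j = o0 /\ I = I0) \/ (j = os /\ I = o0 |: I0).
  move=> jI; rewrite /G /g; case: ifP => [y_lt _|_]; last by rewrite !mulr0 eqxx.
  apply: (rigid N.+1 t ((X t I * t ^ (n - j)) %% q)%N); rewrite -?qE //.
    exact: leq_trans le_N _.
  (* A zero residue would make p^2 divide [X t I], which is c modulo p^2. *)
  rewrite y_lt andbT lt0n; apply/eqP => y0; have := back j I; rewrite y0 mul0n mod0n.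
  move=> /esym /eqP; rewrite -/(dvdn _ _) => /(dvdn_trans p2_q).
  by rewrite /dvdn Xc modn_small // => /eqP c0; rewrite c0 in c_gt0.
(* The sums of t^i and t^(i+s) over I0 cancel, as t^s = -1 modulo q. *)
have XI0 : dvdr (q%:R : int) ((X t I0)%:R - c%:R).
  rewrite /X -addnA -mulnDr natrD addrC addKr natrM; apply: dvdr_mull.
  rewrite natrD !natr_sum -big_split; apply: dvdr_sum => i _.
  rewrite /= expnD natrM !natrX -/T (_ : _ + _ = T ^+ i * (T ^+ s + 1)); last by ring.
  exact: dvdr_mull.
have s_lt : (s < n)%N by rewrite -osE.
have g0 : g (X t I0 * t ^ (n - o0))%N = a ^+ c.
  have -> : g (X t I0 * t ^ (n - o0))%N = g c.
    rewrite /g o0E subn0; suff -> : X t I0 * t ^ n = c %[mod q] by [].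
    apply: modqP; rewrite natrM natrX -/T.
    rewrite (_ : _ - _ = (X t I0)%:R * (T ^+ n - 1) + ((X t I0)%:R - c%:R)); last by ring.
    by apply: dvdr_add => //; apply: dvdr_mull.
  by rewrite /g modn_small ?c_lt // (leq_trans c_lt).
(* The point is c - p^2 modulo q, and multiplication by t^s changes its sign. *)
have gs : g (X t (o0 |: I0) * t ^ (n - os))%N = a ^+ (p ^ 2 - c).
  have -> : g (X t (o0 |: I0) * t ^ (n - os))%N = g (p ^ 2 - c)%N.
    rewrite /g; suff -> : X t (o0 |: I0) * t ^ (n - os) = p ^ 2 - c %[mod q] by [].
    have -> : (n - os = s)%N by rewrite osE n2s; lia.
    apply: modqP; rewrite XU // natrB ?(ltnW c_lt) // natrM natrD natrM !natrX -/T o0E add0n.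
    rewrite (_ : _ - _ = ((X t I0)%:R - c%:R) * T ^+ s + c%:R * (T ^+ s + 1) +
                         p%:R ^+ 2 * (T ^+ n - 1)).
      by apply: dvdr_add; [apply: dvdr_add; [apply: dvdr_mulr|]|]; rewrite ?dvdr_mull //;
         apply: dvdr_mull.
    by rewrite n2s -addnn exprD; ring.
  have lt2 : (p ^ 2 - c < p ^ 2)%N by lia.
  by rewrite /g modn_small ?lt2 // (leq_trans lt2).
have os_o0 : os != o0 by apply/eqP => /(congr1 val) /=; rewrite osE o0E; move: s_gt0; lia.
have osI : os \notin o0 |: I0.
  rewrite in_setU1 (negbTE os_o0) inE osE.
  by rewrite (prim_root_half _ _ _ _ n2s s_gt0 z_prim) (Creal_ImP (-1) _) ?realN ?real1 // ltxx.
have sumE : \sum_(j < n) \sum_(I : {set 'I_n} | j \notin I) G j I = G o0 I0 + G os (o0 |: I0).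
  have S0 : \sum_(I : {set 'I_n} | o0 \notin I) G o0 I = G o0 I0.
    rewrite (bigD1 I0) //= big1 ?addr0 // => I /andP[jI ne].
    apply/eqP; apply: contraT => /(G0 _ _ jI) [[_ IE]|[o0s _]].
      by rewrite IE eqxx in ne.
    by rewrite o0s eqxx in os_o0.
  have Ss : \sum_(I : {set 'I_n} | os \notin I) G os I = G os (o0 |: I0).
    rewrite (bigD1 (o0 |: I0)) //= big1 ?addr0 // => I /andP[jI ne].
    apply/eqP; apply: contraT => /(G0 _ _ jI) [[o0s _]|[_ IE]].
      by rewrite o0s eqxx in os_o0.
    by rewrite IE eqxx in ne.
  rewrite (bigD1 o0) // S0 (bigD1 os) // Ss big1 /= ?addr0 // => j /andP[j0 js].
  apply: big1 => I jI; apply/eqP; apply: contraT.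
  by move=> /(G0 _ _ jI) [[jE _]|[jE _]]; [rewrite jE eqxx in j0 | rewrite jE eqxx in js].
(* The additional element of [o0 |: I0] gives the factor -a^(p^2) in the second term; the common
   unit is then cancelled. *)
move: T0; rewrite TE sumE /G g0 gs o0E osE cardsU1 o0I0 exprS.
rewrite [X in dvdr _ X -> _](_ : _ = (- B) ^+ #|I0| *
  ((1 - a ^+ q) * (e 0%N * a ^+ c - e s * a ^+ (p ^ 2 + (p ^ 2 - c))))).
  by move=> h0; apply: dvdr_pi_unitl h0; rewrite unitrX // unitrN unitrX.
by rewrite [a ^+ (p ^ 2 + _)]exprD -/B; ring.
Qed.

End Convolution.

(** * Roots of unity modulo p^N *)

Lemma Fp_prim_root p : prime p -> exists g : 'F_p, (p.-1).-primitive_root g.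
Proof.
move=> p_pr; have n_gt0 : (0 < p.-1)%N by have := prime_gt1 p_pr; lia.
have cardF := card_Fp p_pr.
suff /hasP[g _ g_prim] : has (p.-1).-primitive_root (enum (predC1 (0 : 'F_p))) by exists g.
apply: has_prim_root => //; last by rewrite -cardE cardC1 cardF.
  apply/allP => x; rewrite mem_enum /= => x0; rewrite unity_rootE.
  apply/eqP/(mulfI x0); rewrite -exprS prednK ?prime_gt0 // mulr1 -[X in _ ^+ X]cardF.
  exact: expf_card.
exact: enum_uniq.
Qed.

Section PrimitiveRoot.

Context (p : nat) (p_pr : prime p) (p_gt2 : (2 < p)%N).

Lemma Fp_natrP k l : (k%:R = l%:R :> 'F_p) <-> k = l %[mod p].
Proof.
split=> [/(congr1 val)|kl]; first by rewrite /= !val_Fp_nat.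
by apply: val_inj; rewrite /= !val_Fp_nat.
Qed.

Lemma Fp_natr0 k : (k%:R == 0 :> 'F_p) = (p %| k)%N.
Proof. by rewrite (dvdn_pcharf (pchar_Fp p_pr)). Qed.

Context (g : 'F_p) (g_prim : (p.-1).-primitive_root g) (N : nat).
Let n := p.-1.
Let q := (p ^ N.+1)%N.
(** Representative modulo p^(N+1) of the Teichmüller lift of [g]. *)
Let t := (g ^ (p ^ N))%N.

Let p_q : (p %| q)%N.
Proof. exact: dvdn_exp. Qed.

Let g_natr : (g : nat)%:R = g.
Proof. exact: natr_Zp. Qed.

Lemma teich_natr : t%:R = g.
Proof.
rewrite natrX g_natr -{2}(expr_expp_pred _ p N g) ?prime_gt0 //.
exact: prim_expr_order.
Qed.

(** The congruence g^((p-1)/2) = -1 modulo p lifts on raising to the power p^N, which is odd and so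
    preserves -1. *)
Lemma teich_half : (q %| t ^ n./2 + 1)%N.
Proof.
have gs := prim_root_half _ _ _ g (pred_prime_half _ p_pr p_gt2)
  (pred_prime_half_gt0 _ p_pr p_gt2) g_prim.
have : dvdr (p%:R : int) ((g : nat)%:R ^+ n./2 - (-1)).
  rewrite opprK -natrX natr1 -addn1; apply: natr_dvd.
  by rewrite -Fp_natr0 natrD natrX g_natr gs addNr.
move=> /(dvdr_subXpX p _ _ _ N p_pr (dvdr_refl _)).
have p_odd : odd p by case: (even_prime p_pr) p_gt2 => [->|].
have odd_pN : odd (p ^ N) by rewrite oddX p_odd orbT.
rewrite -[X in - X]signr_odd odd_pN expr1 opprK -exprM mulnC -!natrX natr1 => -[z].
rewrite -addn1 expnM => e.
have /dvdr_natP : dvdr (q%:R : int) ((t ^ n./2 + 1)%:R - 0%:R) by exists z; rewrite subr0.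
by rewrite mod0n => /eqP.
Qed.

Lemma teich_unity : t ^ n = 1 %[mod q].
Proof.
apply/dvdr_natP; rewrite natrX /n (pred_prime_half _ p_pr p_gt2) -addnn exprD.
have h : dvdr (q%:R : int) (t%:R ^+ n./2 + 1).
  by rewrite -natrX natr1 -addn1; apply: natr_dvd; apply: teich_half.
rewrite (_ : _ - _ = (t%:R ^+ n./2 + 1) * (t%:R ^+ n./2 - 1)); last by ring.
exact: dvdr_mulr.
Qed.

Lemma teich_expr_eqmod j k : (g ^+ j = g ^+ k) -> t ^ j = t ^ k %[mod q].
Proof.
move=> /eqP; rewrite (eq_prim_root_expr g_prim) => /eqP jk.
have red m : t ^ m = t ^ (m %% n) %[mod q].
  rewrite {1}(divn_eq m n) expnD [(m %/ n * n)%N]mulnC expnM -modnMml -modnXm teich_unity modnXm.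
  by rewrite exp1n modnMml mul1n.
by rewrite red jk -red.
Qed.

Lemma unity_teich_expr k : k ^ n = 1 %[mod q] -> exists i : 'I_n, k = t ^ i %[mod q].
Proof.
move=> k1; have [i ki] : {i : 'I_n | k%:R = g ^+ i}.
  apply: (prim_rootP g_prim); rewrite -natrX -[1]/(1%:R); apply/Fp_natrP.
  by rewrite -(modn_dvdm _ p_q) k1 modn_dvdm.
exists i; apply: (eqmod_nroot _ p_pr) => //.
  by rewrite -expnM [(i * _)%N]mulnC expnM -modnXm teich_unity modnXm exp1n.
by apply/Fp_natrP; rewrite natrX teich_natr.
Qed.

End PrimitiveRoot.

(** * Exponents of gamma_n(k) *)

Section DiscreteLog.

Context (p : nat) (p_pr : prime p) (p_gt2 : (2 < p)%N) (N : nat).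
Let n := p.-1.
Let q := (p ^ N.+1)%N.

Let q_gt0 : (0 < q)%N.
Proof. by rewrite expn_gt0 prime_gt0. Qed.

Let p_q : (p %| q)%N.
Proof. exact: dvdn_exp. Qed.

Lemma expn1p_mod e : (1 + p) ^ e = 1 %[mod p].
Proof. by rewrite -modnXm modnDr modnXm exp1n. Qed.

(** The power p - 1 removes u and u'; then p^N divides (e - e')(p - 1), and p - 1 is prime to p. *)
Lemma discrete_log_unique e e' u u' :
    (e < p ^ N)%N -> (e' < p ^ N)%N -> u ^ n = 1 %[mod q] -> u' ^ n = 1 %[mod q] ->
  (1 + p) ^ e * u = (1 + p) ^ e' * u' %[mod q] -> e = e'.
Proof.
wlog le_e : e e' u u' / (e' <= e)%N.
  move=> W; case/orP: (leq_total e' e) => [|/W h ? ? ? ? /esym /h ->//]; exact: W.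
move=> e_lt e'_lt u1 u'1 eu; apply/eqP; rewrite eqn_leq le_e andbT -subn_eq0.
have en : (1 + p) ^ (e * n) = (1 + p) ^ (e' * n) %[mod q].
  have pow k v : v ^ n = 1 %[mod q] -> ((1 + p) ^ k * v) ^ n = (1 + p) ^ (k * n) %[mod q].
    by move=> v1; rewrite expnMn -expnM -modnMmr v1 modnMmr muln1.
  by rewrite -(pow e u) // -(pow e' u') // -modnXm eu modnXm.
have : (q %| (1 + p) ^ ((e - e') * n) - 1)%N.
  have co : coprime q ((1 + p) ^ (e' * n)).
    by rewrite coprimeXl // coprimeXr // /coprime gcdnDr gcdn1.
  rewrite -(Gauss_dvdr _ co) mulnBr muln1 -expnD -mulnDl subnKC // -eqn_mod_dvd.
    by rewrite en.
  by rewrite leq_exp2l ?leq_mul2r ?le_e ?orbT // ltnS prime_gt0.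
move=> /(@natr_dvd int); rewrite natrB ?expn_gt0 // !natrX natrD.
have n_gt0 : (0 < n)%N by rewrite /n -ltnS prednK ?prime_gt0 ?prime_gt1.
have n_lt : (n < p)%N by rewrite /n prednK ?prime_gt0.
have co : coprime (p ^ N) n by apply: coprimeXl; rewrite prime_coprime // gtnNdvd.
move=> /(log1p_unique _ p_pr p_gt2); rewrite Gauss_dvdl //.
have [->//|h] := posnP (e - e'); rewrite gtnNdvd //.
exact: leq_ltn_trans (leq_subr _ _) e_lt.
Qed.

Lemma gexp_eq k e u :
    (e < p ^ N)%N -> u ^ n = 1 %[mod q] -> (1 + p) ^ e * u = k %[mod q] ->
  gexp p N k = e.
Proof.
move=> e_lt u1 eu; rewrite /gexp; case: pickP => [e'|].
  move=> /existsP[u' /and3P[/eqP u'1 _ /eqP eu']].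
  by apply: (discrete_log_unique _ _ u' u); rewrite // eu'.
move=> /(_ (Ordinal e_lt)) /existsP[]; exists (Ordinal (ltn_pmod u q_gt0)).
rewrite /= modnXm modnMmr -/q -/n u1 eu !eqxx /= andbT.
by rewrite -(modn_dvdm k p_q) -eu !modn_dvdm // -modnMml expn1p_mod modnMml mul1n.
Qed.

(** Positivity excludes the default value 0 of [gexp]. *)
Lemma gexpP k : (0 < gexp p N k)%N ->
  exists2 u, u ^ n = 1 %[mod q] & (1 + p) ^ gexp p N k * u = k %[mod q].
Proof.
rewrite {1}/gexp; case: pickP => // e /existsP[u /and3P[/eqP u1 _ /eqP eu]] _.
by exists u => //; rewrite (gexp_eq k e u).
Qed.

Lemma gexp_lt k : (gexp p N k < p ^ N)%N.
Proof. by rewrite /gexp; case: pickP => // _; rewrite expn_gt0 prime_gt0. Qed.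

(** Replacing the root u by -u, still a root as p - 1 is even, shows that both searches have the
    same predicate. *)
Lemma gexp_opp k : (k <= q)%N -> gexp p N (q - k) = gexp p N k.
Proof.
pose B k (e : 'I_(p ^ N)) := [exists u : 'I_(p ^ N.+1),
  [&& (u ^ p.-1 == 1 %[mod p ^ N.+1]), (u == k %[mod p])
    & ((1 + p) ^ e * u == k %[mod p ^ N.+1])]].
suff imp l e : (l <= q)%N -> B l e -> B (q - l)%N e.
  move=> kq; rewrite /gexp (@eq_pick _ _ (B k)) // => e.
  by apply/idP/idP => [/(imp _ _ (leq_subr k q))|/(imp _ _ kq) //]; rewrite subKn.
move=> lq /existsP[u /and3P[/eqP u1 /eqP ul /eqP eu]].
have u_le : (u <= q)%N := ltnW (ltn_ord u).
apply/existsP; exists (Ordinal (ltn_pmod (q - u) q_gt0)); rewrite /= modnXm modnMmr.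
apply/and3P; split; apply/eqP; [|rewrite modn_dvdm //|]; apply/dvdr_natP.
- rewrite [(_ ^ p.-1)%:R]natrX; apply: dvdr_sub_trans (_ : dvdr _ (u%:R ^+ p.-1 - 1)).
    have -> : (u%:R : int) ^+ p.-1 = (- u%:R) ^+ p.-1.
      by rewrite exprNn -signr_odd (pred_prime_half _ p_pr p_gt2) odd_double mul1r.
    by apply: dvdr_subX; rewrite natrB // opprK subrK; apply: dvdr_refl.
  by have /dvdr_natP := u1; rewrite [(u ^ _)%:R]natrX.
- rewrite !natrB // opprB addrC subrKA; exact/dvdr_subC/dvdr_natP.
- rewrite natrM !natrB // (_ : _ - _ =
    q%:R * (((1 + p) ^ e)%:R - 1) - ((((1 + p) ^ e) * u)%:R - l%:R)); last by rewrite natrM; ring.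
  by apply: dvdr_sub; [apply/dvdr_mulr/dvdr_refl|apply/dvdr_natP].
Qed.

Context (g : 'F_p) (g_prim : n.-primitive_root g).
Let t := (g ^ (p ^ N))%N.

(** The fiber of [gexp] over a nonzero exponent is the orbit of x under the (p-1)-th roots of unity
    modulo q, listed as t^(n-j). *)
Lemma gexp_fiber (V : nmodType) (f : nat -> V) (x e : nat) :
    (0 < e < p ^ N)%N -> (1 + p) ^ e = x %[mod q] ->
  \sum_(1 <= k < q | ~~ (p %| k)%N && (gexp p N k == e)) f k =
  \sum_(j < n) f ((x * t ^ (n - j)) %% q)%N.
Proof.
move=> /andP[e_gt0 e_lt] ex.
have n_gt0 : (0 < n)%N := prim_order_gt0 g_prim.
have x1 : x = 1 %[mod p] by rewrite -(modn_dvdm x p_q) -ex modn_dvdm // expn1p_mod.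
pose K (j : 'I_n) := ((x * t ^ (n - j)) %% q)%N.
have Kp j : (K j)%:R = g ^+ (n - j) :> 'F_p.
  rewrite -(teich_natr _ p_pr g g_prim N) -natrX; apply/Fp_natrP => //.
  by rewrite /K modn_dvdm // -modnMml x1 modnMml mul1n.
have g_neq0 : g != 0 by rewrite (prim_root_eq0 g_prim) -lt0n.
rewrite [RHS](_ : _ = \sum_(k <- [seq K j | j <- enum 'I_n]) f k); last first.
  by rewrite big_map big_enum.
rewrite -big_filter; apply: perm_big; apply: uniq_perm.
- exact/filter_uniq/iota_uniq.
- rewrite map_inj_uniq ?enum_uniq // => i j /(congr1 (fun k => k%:R : 'F_p)).
  rewrite !Kp => /eqP; rewrite (eq_prim_root_expr g_prim).
  have expK (l : 'I_n) : g ^+ (n - l) * g ^+ l = 1.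
    by rewrite -exprD subnK ?(prim_expr_order g_prim) // ltnW.
  rewrite -(eq_prim_root_expr g_prim) => /eqP ij.
  have : g ^+ i = g ^+ j.
    by apply: (mulfI (expf_neq0 (n - i) g_neq0)); rewrite [in RHS]ij !expK.
  by move/eqP; rewrite (eq_prim_root_expr g_prim) !modn_small // => /eqP /val_inj.
move=> k; rewrite mem_filter mem_index_iota; apply/idP/mapP; last first.
  move=> [j _ ->]; have pK : ~~ (p %| K j)%N by rewrite -Fp_natr0 // Kp expf_neq0.
  rewrite pK ltn_pmod // andbT lt0n (contraNneq _ pK) ?dvdn0 // => [|-> //].
  rewrite andbT; apply/eqP/(gexp_eq _ _ (t ^ (n - j))%N) => //.
    rewrite -expnM [((n - j) * n)%N]mulnC expnM -modnXm.
    by rewrite (teich_unity _ p_pr p_gt2 _ g_prim) modnXm exp1n.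
  by rewrite -modnMml ex modnMml modn_mod.
move=> /andP[/andP[pk /eqP ke] /andP[_ kq]].
have [|u u1 uk] := gexpP k; first by rewrite ke.
have [i ui] := unity_teich_expr _ p_pr p_gt2 g g_prim N u u1.
(* The reduction modulo n covers i = 0, where the exponent n - j has to be n. *)
have j_lt : ((n - i) %% n < n)%N by rewrite ltn_mod.
exists (Ordinal j_lt); first by rewrite mem_enum.
rewrite -[k](modn_small kq) -uk ke -modnMml ex modnMml -modnMmr ui modnMmr /K /=.
rewrite -modnMmr -[in RHS]modnMmr; congr ((_ * _) %% _)%N.
apply: (teich_expr_eqmod _ p_pr p_gt2 _ g_prim).
have [->|i_gt0] := posnP i; first by rewrite subn0 modnn subn0 (prim_expr_order g_prim).
have ji : ((n - i) %% n = n - i)%N by apply: modn_small; rewrite ltn_subrL i_gt0.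
by rewrite ji (subKn (ltnW (ltn_ord i))).
Qed.

End DiscreteLog.

(** Modulo p^2, (1 + p)^e is 1 + p e, so e is congruent to m modulo p and hence prime to p. *)
Lemma discrete_log_exists p N x m :
    prime p -> (2 < p)%N -> (0 < N)%N -> ~~ (p %| m)%N ->
    x = 1 + p * m %[mod p ^ 2] ->
  exists e, [/\ (e < p ^ N)%N, ~~ (p %| e)%N & (1 + p) ^ e = x %[mod p ^ N.+1]].
Proof.
move=> p_pr p_gt2 N_gt0 pm xm; have pN_gt0 : (0 < p ^ N)%N by rewrite expn_gt0 prime_gt0.
have x1 : x = 1 %[mod p].
  have p_p2 : (p %| p ^ 2)%N by apply: dvdn_exp.
  by rewrite -(modn_dvdm x p_p2) xm modn_dvdm // addnC mulnC modnMDl.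
have [e0 he0] := log1p_exists p p_pr p_gt2 N _ ((dvdr_natP p x 1).2 x1).
have {}he0 : (1 + p) ^ e0 = x %[mod p ^ N.+1].
  by apply/dvdr_natP; rewrite !natrX natrD.
exists (e0 %% p ^ N)%N.
have eN : (1 + p) ^ (e0 %% p ^ N) = x %[mod p ^ N.+1].
  have one : (1 + p) ^ (p ^ N) = 1 %[mod p ^ N.+1].
    apply/dvdr_natP; rewrite [((1 + p) ^ _)%:R]natrX [(p ^ _)%:R]natrX natrD.
    have := dvdr_trans _ _ _ (dvdr_pow (p%:R : int) _ _ (leqnSn N.+1)) (expr1p_pexp _ p_pr p_gt2 N).
    move=> /dvdr_add /(_ (dvdr_refl _)).
    by rewrite opprD addrA subrK.
  rewrite -he0; move: (divn_eq e0 (p ^ N)); move: (e0 %/ _)%N (e0 %% _)%N => d r ->.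
  rewrite expnD [(d * _)%N]mulnC expnM -[in RHS]modnMml -[in RHS]modnXm one modnXm.
  by rewrite exp1n modnMml mul1n.
split=> //; first by rewrite ltn_mod.
move: (e0 %% _)%N eN => e eN; apply: contra pm => /dvdnP[e' ee'].
have : dvdr ((p ^ 2)%:R : int) (((1 + p) ^ e)%:R - (1 + p * m)%:R).
  apply/dvdr_natP; rewrite -xm.
  have p2_q : (p ^ 2 %| p ^ N.+1)%N by apply: dvdn_exp2l.
  by rewrite -(modn_dvdm _ p2_q) eN modn_dvdm.
have := expr1D_sq int p%:R e; rewrite [((1 + p) ^ e)%:R]natrX [(p ^ 2)%:R]natrX !natrD natrM.
move=> h1 h2; have [z] := dvdr_sub _ _ _ h2 h1.
rewrite ee' natrM (_ : _ - _ = p%:R * (e'%:R * p%:R - m%:R)); last by ring.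
rewrite expr2 -mulrA => /mulfI h3.
have p0 : (p%:R : int) != 0 by rewrite pnatr_eq0 -lt0n prime_gt0.
move/(_ p0): h3 => h3.
have /dvdr_natP : dvdr (p%:R : int) (m%:R - 0%:R).
  by exists (e'%:R - z); rewrite subr0 mulrBr -h3; ring.
by rewrite mod0n => /eqP.
Qed.

(** * Coefficientwise congruences of polynomials *)

Lemma poly_dvdrP (R : comNzRingType) (d : R) (P : {poly R}) :
  (forall m, dvdr d P`_m) -> exists Q, P = d *: Q.
Proof.
move=> dP; have /fin_all_exists[f fP] (i : 'I_(size P)) : exists y, P`_i = d * y := dP i.
exists (\sum_(i < size P) f i *: 'X^i); rewrite -{1}[P]coefK poly_def scaler_sumr.
by apply: eq_bigr => i _; rewrite scalerA fP.
Qed.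

Lemma coef_Xadd1_expn_sub1 (R : comNzRingType) (p N j : nat) : prime p -> (j < p ^ N)%N ->
  dvdr p%:R (('X + 1) ^+ (p ^ N) - 1 : {poly R})`_j.
Proof.
move=> p_pr j_lt; have [Q] := expr_primeX_add p ('X : {poly R}) 1 N p_pr.
rewrite expr1n => /(congr1 (fun P : {poly R} => P`_j)).
rewrite -scaler_nat -scalerAl mul1r coefZ coefB coefD coefXn ltn_eqF // add0r -coefB => ->.
by exists Q`_j.
Qed.

(** * The measures and their power series *)

Section MeasureSeries.

Context (p : nat) (O : idomainType) (pi : O) (w : int -> O).
Hypotheses (p_pr : prime p) (p_gt2 : (2 < p)%N) (O_padic : is_padic_integers p pi).
Hypothesis w_teich : is_teichmuller p pi w.
Let n := p.-1.

Let n_gt0 : (0 < n)%N.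
Proof. by rewrite /n -ltnS prednK ?prime_gt0 ?prime_gt1. Qed.

Lemma teich_unityr k : ~~ (p %| k)%N -> w k ^+ n = 1.
Proof. by move=> pk; have [] := w_teich k pk. Qed.

Lemma teich_mod (k : nat) : ~~ (p %| k)%N -> dvdr pi (w k - k%:R).
Proof. by move=> pk; have [] := w_teich k pk. Qed.

Lemma teich_eq (k : nat) x : ~~ (p %| k)%N -> x ^+ n = 1 -> dvdr pi (x - k%:R) -> w k = x.
Proof.
move=> pk x1 xk; apply: (nroot_pi_inj _ _ _ p_pr O_padic) => //; first exact: teich_unityr.
exact: dvdr_sub_trans (teich_mod _ pk) (dvdr_subC _ _ _ xk).
Qed.

Lemma sign_unity k : (-1) ^+ k ^+ n = 1 :> O.
Proof.
rewrite -exprM mulnC exprM -[X in X ^+ k]signr_odd /n (pred_prime_half _ p_pr p_gt2).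
by rewrite odd_double expr0 expr1n.
Qed.

Lemma teich_m1 : w (-1) = -1.
Proof.
have [] := w_teich (-1).
  by rewrite dvdzE /= dvdn1; case: (p) p_gt2 => [|[]].
move=> w1 wm; apply: (nroot_pi_inj _ _ _ p_pr O_padic) => //.
exact: (sign_unity 1).
Qed.

Lemma teich_opp q k : (p %| q)%N -> (k <= q)%N -> ~~ (p %| k)%N -> w (q - k)%N = - w k.
Proof.
move=> pq kq pk; apply: teich_eq.
- by rewrite dvdn_subr.
- by rewrite exprNn (sign_unity 1) teich_unityr // mul1r.
rewrite natrB // (_ : _ - _ = - (w k - k%:R) - q%:R); last by ring.
apply: dvdr_sub; first exact/dvdr_opp/teich_mod.
exact: dvdr_trans (dvdr_pi_p _ _ _ O_padic) (natr_dvd _ _ pq).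
Qed.

Context (g : 'F_p) (g_prim : n.-primitive_root g).

Let g_natr : (g : nat)%:R = g.
Proof. exact: natr_Zp. Qed.

Lemma prim_root_ndvd : ~~ (p %| (g : nat))%N.
Proof. by rewrite -Fp_natr0 // g_natr (prim_root_eq0 g_prim) -lt0n. Qed.

Let pg := prim_root_ndvd.

Lemma teich_prim : n.-primitive_root (w (g : nat)).
Proof.
have [m m_prim m_n] := prim_order_exists n_gt0 (teich_unityr _ pg).
suff -> : n = m by [].
apply/eqP; rewrite eqn_dvd m_n andbT (prim_order_dvd g_prim) -g_natr -natrX.
have pi_gm : dvdr pi (((g : nat) ^ m - 1)%N%:R : O).
  have g_gt0 : (0 < (g : nat))%N by rewrite lt0n; apply: contraNneq pg => ->; apply: dvdn0.
  rewrite natrB ?expn_gt0 ?g_gt0 // natrX -[X in _ - X](prim_expr_order m_prim).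
  exact/dvdr_subX/dvdr_subC/teich_mod.
have := dvdr_pi_natr _ _ _ p_pr p_gt2 O_padic _ pi_gm.
have g_gt0 : (0 < (g : nat) ^ m)%N.
  by rewrite expn_gt0 lt0n; apply/orP; left; apply: contraNneq pg => ->; apply: dvdn0.
rewrite -eqn_mod_dvd // => /eqP gm; apply/eqP.
exact/(Fp_natrP _ p_pr (_ ^ m)%N 1).
Qed.

Lemma teich_expr (k j : nat) : k%:R = g ^+ j -> w k = w (g : nat) ^+ j.
Proof.
move=> kg; have pk : ~~ (p %| k)%N.
  by rewrite -Fp_natr0 // kg expf_neq0 // (prim_root_eq0 g_prim) -lt0n.
apply: teich_eq => //; first by rewrite -exprM mulnC exprM teich_unityr // expr1n.
apply: dvdr_sub_trans (dvdr_subX _ _ _ j (teich_mod _ pg)) _; rewrite -natrX.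
apply: dvdr_trans (dvdr_pi_p _ _ _ O_padic) (natr_eqmod _ _ _ _).
by apply/(Fp_natrP _ p_pr); rewrite natrX g_natr kg.
Qed.

Lemma teich_approx N : dvdr (pi ^+ N.+1) (((g : nat) ^ (p ^ N))%N%:R - w (g : nat)).
Proof.
have p_gt0 := prime_gt0 p_pr.
rewrite natrX -[w _](expr_expp_pred _ p N) //; last exact: teich_unityr.
apply: (dvdr_subXpX _ _ _ _ _ p_pr (dvdr_pi_p _ _ _ O_padic)).
exact/dvdr_subC/teich_mod.
Qed.

Context (i : nat) (a : O).
Hypotheses (pi_a : ~ dvdr pi a) (pi_a1 : ~ dvdr pi (a - 1)).

Lemma measure_base_unit : a \in GRing.unit.
Proof. by have [|/pi_a] := unit_or_dvdr_pi _ _ _ O_padic a. Qed.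

Lemma Xpn_sub1_unit N : a ^+ (p ^ N) - 1 \in GRing.unit.
Proof.
have [//|] := unit_or_dvdr_pi _ _ _ O_padic (a ^+ (p ^ N) - 1).
by move/(dvdr_pi_Xpn_sub1 _ _ _ p_pr O_padic _ N)/pi_a1.
Qed.

Let b N k := (a ^+ k / (a ^+ (p ^ N.+1) - 1)) * theta_omega_inv w i k.

Lemma coef_Mpoly_ge N m : (p ^ N <= m)%N -> (Mpoly p N w i a)`_m = 0.
Proof.
move=> m_ge; rewrite coef_sum big1 // => k _; rewrite coefZ nth_default ?mulr0 //.
have -> : 'X + 1 = 'X - (-1)%:P :> {poly O} by rewrite polyCN opprK.
by rewrite size_exp_XsubC (leq_trans (gexp_lt _ p_pr _ _)).
Qed.

(** Modulo [pi], (1 + T)^(p^N) - 1 is T^(p^N), so its multiples do not affect degrees below p^N. *)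
Lemma Mseries_mod F N m : is_Mseries p w i a F -> (m < p ^ N)%N ->
  dvdr pi (F m - (Mpoly p N w i a)`_m).
Proof.
move=> /(_ N)[G ->] m_lt; apply: dvdr_sum => j _; apply: dvdr_mulr.
apply: dvdr_trans (dvdr_pi_p _ _ _ O_padic) (coef_Xadd1_expn_sub1 _ _ _ _ p_pr _).
by apply: leq_ltn_trans m_lt; rewrite -ltnS.
Qed.

(** In the variable 1 + T the sum is the coefficient of degree e; e times it is a coefficient of the
    derivative, hence zero modulo [pi], and e is a unit. *)
Lemma fiber_sum_dvdr F N e : is_Mseries p w i a F ->
    (forall j : nat, dvdr pi (j.+1%:R * F j.+1)) -> ~~ (p %| e)%N ->
  dvdr pi (\sum_(1 <= k < p ^ N.+1 | ~~ (p %| k)%N && (gexp p N k == e)) b N k).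
Proof.
move=> FM dF pe.
have dM m : dvdr pi (Mpoly p N w i a)^`()`_m.
  rewrite coef_deriv -mulr_natl; case: (ltnP m.+1 (p ^ N)) => [m_lt|m_ge]; last first.
    by rewrite coef_Mpoly_ge // mulr0; apply: dvdr0.
  have := dvdr_sub _ _ _ (dF m) (dvdr_mull _ m.+1%:R _ (Mseries_mod _ _ _ FM m_lt)).
  by congr dvdr; ring.
have [Q QE] := poly_dvdrP _ _ _ dM.
have compE : Mpoly p N w i a \Po ('X - 1) =
    \sum_(1 <= k < p ^ N.+1 | ~~ (p %| k)%N) b N k *: 'X^(gexp p N k).
  rewrite /Mpoly raddf_sum; apply: eq_bigr => k _; rewrite /= comp_polyZ.
  by rewrite rmorphXn rmorphD /= comp_polyX comp_polyC subrK.
have : (Mpoly p N w i a \Po ('X - 1))^`() = pi *: (Q \Po ('X - 1)).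
  by rewrite deriv_comp QE derivB derivX derivC subr0 mulr1 comp_polyZ.
case: e pe => [|e] pe; first by rewrite dvdn0 in pe.
rewrite compE => /(congr1 (fun P : {poly O} => P`_e)).
rewrite coef_deriv coefZ coef_sum -mulr_natl => E.
apply: (dvdr_pi_unitl _ _ _ _ (natr_unit _ _ _ p_pr p_gt2 O_padic _ pe)).
exists (Q \Po ('X - 1))`_e; rewrite -E big_mkcondr; congr (_ * _); apply: eq_bigr => k _.
by rewrite coefZ coefXn eq_sym; case: eqP => _; rewrite ?mulr1 ?mulr0.
Qed.

(** The value of theta omega^-1 at the root of unity w(g)^(n-j), attached to the j-th point of an
    orbit. *)
Let e j := w (g : nat) ^+ (n - j) ^+ i * (w (g : nat) ^+ (n - j))^-1.

Lemma orbit_sum_dvdr F N m x : is_Mseries p w i a F ->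
    (forall j : nat, dvdr pi (j.+1%:R * F j.+1)) -> (0 < N)%N -> ~~ (p %| m)%N ->
    x = 1 + p * m %[mod p ^ 2] ->
  dvdr pi (\sum_(j < n) e j * a ^+ ((x * (g ^ (p ^ N)) ^ (n - j)) %% p ^ N.+1)).
Proof.
move=> FM dF N_gt0 pm xm.
have [d [d_lt pd dx]] := discrete_log_exists _ _ _ _ p_pr p_gt2 N_gt0 pm xm.
have d_gt0 : (0 < d)%N by case: d pd {d_lt dx}; rewrite ?dvdn0.
have p_q : (p %| p ^ N.+1)%N by apply: dvdn_exp.
have x1 : x = 1 %[mod p] by rewrite -(modn_dvdm x p_q) -dx modn_dvdm // expn1p_mod.
have d_bd : (0 < d < p ^ N)%N by rewrite d_gt0.
have := fiber_sum_dvdr F N d FM dF pd.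
rewrite (gexp_fiber _ p_pr p_gt2 N g g_prim _ (b N) x d d_bd dx).
pose u := a ^+ (p ^ N.+1) - 1; have uu : u \in GRing.unit by apply: Xpn_sub1_unit.
move/(dvdr_mull _ u); congr dvdr; rewrite mulr_sumr; apply: eq_bigr => j _.
set k := (_ %% _)%N; have kg : k%:R = g ^+ (n - j).
  rewrite -(teich_natr _ p_pr g g_prim N) -natrX; apply/Fp_natrP => //.
  by rewrite /k modn_dvdm // -modnMml x1 modnMml mul1n.
rewrite /b /theta_omega_inv (teich_expr _ _ kg) -/u /e.
rewrite -[RHS]mul1r -(mulrV uu); move: (u^-1) (_ ^-1) => v y.
by ring.
Qed.

Lemma derivative_dvdr_rigid F : (5 <= p)%N -> is_Mseries p w i a F ->
    (forall j : nat, dvdr pi (j.+1%:R * F j.+1)) ->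
  dvdr pi (a + 1) /\ w (-1) ^+ i = -1.
Proof.
move=> p_ge5 FM dF; have a_unit := measure_base_unit.
have w_prim := teich_prim.
have [z z_prim] := C_prim_root_exists n_gt0.
have n2s : n = n./2.*2 := pred_prime_half _ p_pr p_gt2.
have s_gt0 : (0 < n./2)%N := pred_prime_half_gt0 _ p_pr p_gt2.
have s_lt : (n./2 < n)%N by rewrite [X in (_ < X)%N]n2s -addnn -[X in (X < _)%N]addn0 ltn_add2l.
(* This is theta omega^-1 at -1. *)
pose eps : O := - (-1) ^+ i.
have e0 : e 0 = 1.
  by rewrite /e subn0 (prim_expr_order w_prim) expr1n invr1 mulr1.
have es : e n./2 = eps.
  have -> : e n./2 = (-1) ^+ i * (-1)^-1.
    rewrite /e; have -> : (n - n./2 = n./2)%N by rewrite [X in (X - _)%N]n2s -addnn addnK.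
    by rewrite (prim_root_half _ _ _ _ n2s s_gt0 w_prim).
  by rewrite invrN1 mulrN1.
have rel m : (0 < m < 3)%N ->
    dvdr pi (a ^+ (1 + p * m) - eps * a ^+ (p ^ 2 + (p ^ 2 - (1 + p * m)))).
  move=> /andP[m_gt0 m_lt]; have pm : ~~ (p %| m)%N.
    by rewrite gtnNdvd //; apply: leq_trans m_lt _; apply: leq_trans p_ge5.
  have c_bd : (0 < 1 + p * m < p ^ 2)%N.
    rewrite /= add1n expnS expn1; apply: leq_trans (_ : p * m.+1 <= _)%N;
      by rewrite ?leq_mul2l ?mulnS; lia.
  have [N0] := orbit_relation_rigidity p O pi _ a e _ p_pr p_gt2 O_padic z
    (Ordinal n_gt0) (Ordinal s_lt) w_prim z_prim (erefl _) (erefl _) a_unit c_bd.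
  move=> /(_ N0.+1 ((g : nat) ^ (p ^ N0.+1))%N (leqnSn _) (ltn0Sn _)).
  move=> /(_ (teich_half _ p_pr p_gt2 g g_prim _) (teich_approx _)).
  move=> /(_ (fun x => orbit_sum_dvdr F N0.+1 m x FM dF (ltn0Sn _) pm)).
  rewrite e0 mul1r -/n es; apply: dvdr_pi_unitl.
  by rewrite -opprB unitrN Xpn_sub1_unit.
have c2_lt : (1 + p * 2 <= p ^ 2)%N by rewrite expnS expn1; nia.
(* For c + l = p^2 the exponent 2 p^2 - c is c + 2l, so a^c can be divided out. *)
have rel' m l : (0 < m < 3)%N -> (1 + p * m + l = p ^ 2)%N -> dvdr pi (1 - eps * (a ^+ 2) ^+ l).
  move=> /rel h cl; apply: (dvdr_pi_unitl _ _ (a ^+ (1 + p * m))); first exact: unitrX.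
  move: h; rewrite -cl addKn mulrBr mulr1 mulrCA -exprM -exprD.
  by congr (dvdr _ (_ - _ * _ ^+ _)); lia.
pose l := (p ^ 2 - (1 + p * 2))%N.
have h2 : dvdr pi (1 - eps * (a ^+ 2) ^+ l) by apply: (rel' 2) => //; rewrite subnKC.
have h1 : dvdr pi (1 - eps * (a ^+ 2) ^+ (l + p)) by apply: (rel' 1) => //; rewrite /l; lia.
(* The two relations differ by the factor a^(2p), which is therefore 1 modulo [pi]. *)
have a2 : dvdr pi (a ^+ 2 - 1).
  apply: (dvdr_pi_Xpn_sub1 _ _ _ p_pr O_padic _ 1); rewrite expn1.
  have := dvdr_sub _ _ _ (dvdr_mulr _ _ ((a ^+ 2) ^+ p) h2) h1.
  by congr dvdr; rewrite exprD; ring.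
have a1 : dvdr pi (a + 1).
  have : dvdr pi ((a - 1) * (a + 1)) by move: a2; congr dvdr; ring.
  by move/(dvdr_pi_prime _ _ _ O_padic) => [/pi_a1|].
split=> //; rewrite teich_m1 -signr_odd; case: (boolP (odd i)) => [_|even_i].
  by rewrite expr1.
(* For even i, eps = -1 and a^2 = 1 would give 2 = 0 modulo [pi]. *)
have : dvdr pi (2%:R : O).
  have a2l : dvdr pi ((a ^+ 2) ^+ l - 1) by rewrite -[X in _ - X](expr1n _ l); apply: dvdr_subX.
  have := dvdr_add _ _ _ h2 (dvdr_mull _ eps _ a2l); congr dvdr.
  rewrite /eps -signr_odd (negbTE even_i) expr0; ring.
by move/(dvdr_pi_natr _ _ _ p_pr p_gt2 O_padic); rewrite gtnNdvd.
Qed.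

(** Pair k with q - k: [gexp] agrees, theta omega^-1 agrees because theta and omega are both odd,
    and a^k + a^(q-k) is zero modulo [pi] since q is odd. *)
Lemma Mpoly_opp_dvdr N m : dvdr pi (a + 1) -> w (-1) ^+ i = -1 ->
  dvdr pi (Mpoly p N w i a)`_m.
Proof.
rewrite teich_m1 => a1 odd_i; set q := (p ^ N.+1)%N.
have p_q : (p %| q)%N by apply: dvdn_exp.
have odd_q : odd q.
  by rewrite oddX /=; case: (even_prime p_pr) p_gt2 => [->|->].
(* The sum plus its reflection is twice the coefficient, and 2 is a unit. *)
apply: (dvdr_pi_unitl _ _ _ _ (natr_unit _ _ _ p_pr p_gt2 O_padic 2 _)).
  by rewrite gtnNdvd.
pose f k : O := b N k * (('X + 1) ^+ gexp p N k : {poly O})`_m.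
have ME : (Mpoly p N w i a)`_m = \sum_(1 <= k < q | ~~ (p %| k)%N) f k.
  by rewrite coef_sum; apply: eq_bigr => k _; rewrite coefZ.
have ME' : (Mpoly p N w i a)`_m = \sum_(1 <= k < q | ~~ (p %| k)%N) f (q - k)%N.
  rewrite ME big_nat_rev /= [LHS]big_nat_cond [RHS]big_nat_cond.
  apply: eq_big => [k|k _]; last by rewrite add1n subSS.
  rewrite add1n subSS; case: (boolP (1 <= k < q)%N) => //= /andP[_ kq].
  by rewrite dvdn_subr // ltnW.
rewrite mulr_natl mulr2n {1}ME ME' -big_split /= big_nat_cond.
apply: dvdr_sum => k /andP[/andP[k_gt0 kq] pk].
rewrite /f gexp_opp ?(ltnW kq) // -mulrDl; apply: dvdr_mulr.
have theta_opp : theta_omega_inv w i (q - k) = theta_omega_inv w i k.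
  rewrite /theta_omega_inv teich_opp ?(ltnW kq) // exprNn odd_i invrN mulrN.
  by rewrite mulN1r mulNr opprK.
rewrite /b theta_opp -mulrDl -mulrDl -/q; apply/dvdr_mulr/dvdr_mulr.
have aX l : dvdr pi (a ^+ l - (-1) ^+ l) by apply: dvdr_subX; rewrite opprK.
have := dvdr_add _ _ _ (aX k) (aX (q - k)%N); congr dvdr.
have -> : (-1) ^+ (q - k) = - (-1) ^+ k :> O.
  rewrite -signr_odd oddB ?(ltnW kq) // odd_q -[in RHS]signr_odd.
  by case: (odd k); rewrite ?expr0 ?expr1 ?opprK.
by ring.
Qed.

End MeasureSeries.

Theorem theorem3p3 (p : nat) (O : idomainType) (pi : O) (w : int -> O)
  (i : 'I_(p.-1)) (a : O) (F : nat -> O) :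
  prime p -> (5 <= p)%N ->
  is_padic_integers p pi -> is_teichmuller p pi w ->
  ~ dvdr pi (a * (a - 1)) ->
  is_Mseries p w i a F ->
  ((forall j : nat, dvdr pi (j.+1%:R * F j.+1)) <->
   (dvdr pi (a + 1) /\ w (-1) ^+ i = -1)).
Proof.
move=> p_pr p_ge5 O_padic w_teich pi_a FM.
have p_gt2 : (2 < p)%N := ltnW (ltnW p_ge5).
have pi_a0 : ~ dvdr pi a by move=> h; apply/pi_a/dvdr_mulr.
have pi_a1 : ~ dvdr pi (a - 1) by move=> h; apply/pi_a/dvdr_mull.
split=> [dF|[a1 odd_i] j].
  have [g g_prim] := Fp_prim_root p p_pr.
  exact: (derivative_dvdr_rigid _ _ _ _ p_pr p_gt2 O_padic w_teich _ g_prim _ _ pi_a0 pi_a1 F).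
(* Level N = j + 1 is deep enough to read off the coefficient of degree j + 1 modulo [pi]. *)
apply: dvdr_mull; have j_lt : (j.+1 < p ^ j.+1)%N by apply: ltn_expl; apply: ltnW.
have := dvdr_add _ _ _ (Mseries_mod _ _ _ _ p_pr O_padic _ _ _ _ _ FM j_lt)
  (Mpoly_opp_dvdr _ _ _ _ p_pr p_gt2 O_padic w_teich _ _ j.+1 j.+1 a1 odd_i).
by rewrite subrK.
Qed.
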